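(* Let $(M,\omega)$ be a connected symplectic Fréchet manifold endowed with a symplectic action of a Fréchet Lie group $G$ with Lie algebra $\mathfrak g$, and let $j$ be an almost complex structure on $M$ compatible with $\omega$. Assume that the action has a momentum map $J:M\to\mathfrak g$ with non-equivariance cocycle $\Sigma$ relative to a non-degenerate symmetric positive-definite pairing $\kappa:\mathfrak g\times\mathfrak g\to\mathbb R$. For $m\in M$, let $\mathfrak t\subseteq\mathfrak g_m$ be an Abelian subalgebra such that $j_m$ and $\kappa$ are invariant under $\mathfrak t$. In infinite dimensions, additionally assume: (1) the adjoints of $\operatorname{ad}_\xi:\mathfrak g\to\mathfrak g$ with respect to $\kappa$ exist for all $\xi\in\mathfrak g$; (2) the map $\Sigma_\kappa:\mathfrak g\to\mathfrak g$ defined by $\kappa(\Sigma_\kappa(\xi),\eta)=\Sigma(\xi,\eta)$ exists; (3) the stabilizer $(\mathfrak g_{\mathbb C})_m$ is finite-dimensional. Then $$(\mathfrak g_{\mathbb C})_m=\mathfrak z(\mathfrak t)\oplus\bigoplus_{\lambda\neq0}\mathfrak k_\lambda,$$ where: (i) $\mathfrak z(\mathfrak t)$ is the subspace of $(\mathfrak g_{\mathbb C})_m$ consisting of the elements that commute with all $\mu\in\mathfrak t$; (ii) $\mathfrak t_{\mathbb C}\subseteq\mathfrak z(\mathfrak t)$; (iii) $\lambda$ ranges over those real-valued linear functionals on $\mathfrak t$ for which $\mathfrak k_\lambda=\{\zeta\in(\mathfrak g_{\mathbb C})_m : \mathrm i\operatorname{ad}_\mu\zeta=\lambda(\mu)\zeta\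 \text{for all }\mu\in\mathfrak t\}$ is non-trivial; in particular $\mathfrak z(\mathfrak t)=\mathfrak k_0$; (iv) $[\mathfrak k_\lambda,\mathfrak k_\nu]\cap(\mathfrak g_{\mathbb C})_m\subseteq\mathfrak k_{\lambda+\nu}$ for all $\lambda,\nu\in\mathfrak t^*$; (v) if $\lambda\neq\nu$, then $\mathfrak k_\lambda$ and $\mathfrak k_\nu$ are orthogonal with respect to $\kappa_{\mathbb C}$.
   Context: Symplectic forms are weak: $\omega$ is closed and $X\mapsto\omega_m(X,\cdot)$ is injective. $\Upsilon_g:M\to M$ is the action of $g\in G$ (a left action); $\xi\cdot m=\frac{d}{dt}|_{t=0}\Upsilon_{\exp(t\xi)}(m)$ is the infinitesimal action, and $\mathfrak g_m=\{\xi\in\mathfrak g:\xi\cdot m=0\}$. A momentum map $J:M\to\mathfrak g$ relative to $\kappa$ satisfies $\omega_m(\xi\cdot m,X)+\kappa(T_mJ(X),\xi)=0$ for all $m\in M$, $X\in T_mM$, $\xi\in\mathfrak g$; neither equivariance of $J$ nor invariance of $\kappa$ under the adjoint action is assumed. The non-equivariance cocycle is $\Sigma(\xi,\eta)=\kappa(J(m),[\xi,\eta])+\omega_m(\xi\cdot m,\eta\cdot m)$, which is independent of $m$. An almost complex structure is a smooth family of linear maps $j_m:T_mM\to T_mM$ with $j_m^2=-\mathrm{id}$ (no integrability is assumed); it is compatible with $\omega$ if $\omega(j\cdot,j\cdot)=\omega$ and $\omega(X,jX)>0$ for $X\neq0$. $j$ is not assumed to be $G$-invariant. Put $\tau_j(g)=T\Upsilon_g\circ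 j\circ T\Upsilon_{g^{-1}}-j$ and $\tau_j'(\xi)=\frac{d}{dt}|_{t=0}\tau_j(\exp(t\xi))$. ''$j_m$ is invariant under $\mathfrak t$'' means $\tau_j'(\mu)_m=0$ on $T_mM$ for all $\mu\in\mathfrak t$. ''$\kappa$ is invariant under $\mathfrak t$'' means $\kappa(\operatorname{ad}_\mu\xi,\eta)+\kappa(\xi,\operatorname{ad}_\mu\eta)=0$ for all $\mu\in\mathfrak t$, $\xi,\eta\in\mathfrak g$. $\mathfrak g_{\mathbb C}=\mathfrak g\oplus\mathrm i\mathfrak g$ carries the complex-bilinear bracket. $\kappa_{\mathbb C}$ is the Hermitian extension of $\kappa$ to $\mathfrak g_{\mathbb C}$ (complex-linear in the first, antilinear in the second argument). The infinitesimal action is extended by $(\xi_1+\mathrm i\xi_2)\cdot m=\xi_1\cdot m+j_m(\xi_2\cdot m)$, and $(\mathfrak g_{\mathbb C})_m=\{\zeta\in\mathfrak g_{\mathbb C}:\zeta\cdot m=0\}$; this is a complex subspace but not necessarily a Lie subalgebra. *)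

(* Defs.v *)
From HB Require Import structures.
From mathcomp Require Import all_boot all_order all_algebra.
From mathcomp Require Import all_classical all_reals all_analysis.
From mathcomp Require Import complex.

Set Implicit Arguments.
Unset Strict Implicit.
Unset Printing Implicit Defensive.

Import Order.TTheory GRing.Theory Num.Theory.
Import numFieldNormedType.Exports.

Local Open Scope classical_set_scope.
Local Open Scope ring_scope.

Section LinearAlgebra.
Context {K : nzRingType} {V : lmodType K}.

Definition is_subspace (S : set V) : Prop := submod_closed [in S].

Definition linear_span (S : set V) : set V := smallest [set W | is_subspace W] S.

Definition finite_dimensional (S : set V) : Prop :=
  exists n (b : 'I_n -> V), forall v, S v ->
    exists c : 'I_n -> K, v = \sum_i c i *: b i.

(* [S] is the internal (algebraic) direct sum of the [W i], [i] in [A]. *)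
Definition is_direct_sum {I : choiceType} (S : set V) (A : set I)
    (W : I -> set V) : Prop :=
  let family (z : I -> V) := [/\ forall i, A i -> W i (z i),
    forall i, ~ A i -> z i = 0 & finite_set [set i | z i != 0]] in
  [/\ forall i, A i -> is_subspace (W i),
      S = [set v | exists2 z, family z & v = \sum_(i \in A) z i] &
      forall z, family z -> \sum_(i \in A) z i = 0 -> forall i, z i = 0].

End LinearAlgebra.

Section Calculus.
Context {R : realType}.

(* The uniform structure of a [tvsType] induces its topology but is not required
   to be translation invariant, so Cauchy sequences are expressed through the
   neighbourhoods of 0; under metrizability, sequential completeness suffices. *)
Definition frechet_space (E : tvsType R) : Prop :=
  [/\ hausdorff_space E,
      exists B : nat -> set E, (forall n, nbhs (0 : E) (B n)) /\
        forall U, nbhs (0 : E) U -> exists n, B n `<=` U &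
      forall u : nat -> E,
        (forall U, nbhs (0 : E) U ->
           exists N, forall p q, (N <= p)%N -> (N <= q)%N -> U (u p - u q)) ->
        exists l : E, u @ \oo --> l].

Section Derivative.
Context {E F : tvsType R}.

Definition quotient_at (f : E -> F) (x v : E) (h : R) : F :=
  h^-1 *: (f (h *: v + x) - f x).

Definition gderivable (f : E -> F) (x v : E) : Prop :=
  exists l : F, quotient_at f x v h @[h --> (0 : R)^'] --> l.

(* The library's [derive] and [derivable] are restricted to normed modules. *)
Definition gderive (f : E -> F) (x v : E) : F :=
  xget 0 [set l : F | quotient_at f x v h @[h --> (0 : R)^'] --> l].

End Derivative.

(* Michal-Bastiani C^k maps; meaningful for open [U]. *)
Fixpoint Ck_on (k : nat) (E F : tvsType R) (U : set E) (f : E -> F) : Prop :=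
  (forall x, U x -> {for x, continuous f}) /\
  if k is k'.+1 then
    (forall x v, U x -> gderivable f x v) /\
    Ck_on k' (U `*` [set: E]) (fun p : E * E => gderive f p.1 p.2)
  else True.

Definition smooth_on (E F : tvsType R) (U : set E) (f : E -> F) : Prop :=
  forall k, Ck_on k U f.

End Calculus.

Section Manifolds.
Context {R : realType}.

(* [coord] and [param] are total functions; only their values on [dom] and
   [coord @` dom] matter. *)
Record chart (M : topologicalType) (E : tvsType R) := Chart {
  dom : set M;
  coord : M -> E;
  param : E -> M;
  dom_open : open dom;
  cod_open : open (coord @` dom);
  coordK : forall m, dom m -> param (coord m) = m;
  coord_continuous : forall m, dom m -> {for m, continuous coord};
  param_continuous : forall x, (coord @` dom) x -> {for x, continuous param}
}.

Definition cod (M : topologicalType) (E : tvsType R) (c : chart M E) : set E :=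
  coord c @` dom c.

Section FlatChart.
Context {E : tvsType R}.

Let id_cod_open : open (idfun @` [set: E]).
Proof. by rewrite image_id; exact: openT. Qed.

Definition flat_chart : chart E E :=
  @Chart E E setT idfun idfun openT id_cod_open (fun _ _ => erefl)
    (fun m _ => @cvg_id _ _) (fun m _ => @cvg_id _ _).

End FlatChart.

Section ProdChart.
Context {M N : topologicalType} {E F : tvsType R}.
Context (a : chart M E) (b : chart N F).

Let pdom : set (M * N) := dom a `*` dom b.
Let pcoord (p : M * N) : E * F := (coord a p.1, coord b p.2).
Let pparam (x : E * F) : M * N := (param a x.1, param b x.2).

Let prod_open (S T : topologicalType) (A : set S) (B : set T) :
  open A -> open B -> open (A `*` B).
Proof.
rewrite !openE => oA oB [x y] [/= Ax By].
by exists (A, B) => //; split; [exact: oA|exact: oB].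
Qed.

Let pcodE : pcoord @` pdom = cod a `*` cod b.
Proof.
apply/seteqP; split=> [_ [[m n] [/= am bn] <-]|[x y] [/= [m am <-] [n bn <-]]].
  by split; [exists m|exists n].
by exists (m, n).
Qed.

Let pdom_open : open pdom.
Proof. exact: prod_open (@dom_open _ _ a) (@dom_open _ _ b). Qed.

Let pcod_open : open (pcoord @` pdom).
Proof.
by rewrite pcodE; exact: prod_open (@cod_open _ _ a) (@cod_open _ _ b).
Qed.

Let pcoordK m : pdom m -> pparam (pcoord m) = m.
Proof. by case: m => m n [/= am bn]; rewrite /pparam /= !coordK. Qed.

Let pcoord_continuous m : pdom m -> {for m, continuous pcoord}.
Proof.
case: m => m n [/= am bn]; apply: cvg_pair => /=.
  by apply: (@continuous_comp _ _ _ fst (coord a) (m, n));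
    [exact: cvg_fst|exact: coord_continuous].
by apply: (@continuous_comp _ _ _ snd (coord b) (m, n));
  [exact: cvg_snd|exact: coord_continuous].
Qed.

Let pparam_continuous x :
  (pcoord @` pdom) x -> {for x, continuous pparam}.
Proof.
rewrite pcodE; case: x => x y [/= ax byy]; apply: cvg_pair => /=.
  by apply: (@continuous_comp _ _ _ fst (param a) (x, y));
    [exact: cvg_fst|exact: param_continuous].
by apply: (@continuous_comp _ _ _ snd (param b) (x, y));
  [exact: cvg_snd|exact: param_continuous].
Qed.

Definition prod_chart : chart (M * N)%type (E * F)%type :=
  Chart pdom_open pcod_open pcoordK pcoord_continuous pparam_continuous.

End ProdChart.

(* An atlas selects a chart around each point. The tangent space at [m] is then
   the model space, read through the chart selected at [m]. *)
Definition atlas (M : topologicalType) (E : tvsType R) := M -> chart M E.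

Definition flat (E : tvsType R) : atlas E E := fun _ => flat_chart.

Definition prod_atlas (M N : topologicalType) (E F : tvsType R)
    (A : atlas M E) (B : atlas N F) : atlas (M * N)%type (E * F)%type :=
  fun p => prod_chart (A p.1) (B p.2).

Definition is_manifold (M : topologicalType) (E : tvsType R)
    (A : atlas M E) : Prop :=
  [/\ hausdorff_space M,
      forall m, dom (A m) m &
      forall m n, smooth_on (cod (A m) `&` param (A m) @^-1` dom (A n))
        (coord (A n) \o param (A m))].

Section Maps.
Context {M N : topologicalType} {E F : tvsType R}.
Context (A : atlas M E) (B : atlas N F).

Definition smooth (f : M -> N) : Prop :=
  continuous f /\
  forall m n, smooth_on (cod (A m) `&` (f \o param (A m)) @^-1` dom (B n))
    (coord (B n) \o f \o param (A m)).

(* T_m f : T_m M -> T_(f m) N *)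
Definition tmap (f : M -> N) (m : M) (X : E) : F :=
  gderive (coord (B (f m)) \o f \o param (A m)) (coord (A m) m) X.

End Maps.

Definition velocity (M : topologicalType) (E : tvsType R) (A : atlas M E)
    (c : R^o -> M) (t : R) : E := tmap (@flat R^o) A c t 1.

End Manifolds.

#[short(type="preTopologicalGroupType")]
HB.structure Definition PreTopologicalGroup :=
  {G of Topological G & Group G}.

Section LieGroups.
Context {R : realType} {G : preTopologicalGroupType} {g : tvsType R}.
Context (A : atlas G g).

Definition is_lie_group : Prop :=
  [/\ is_manifold A,
      smooth (prod_atlas A A) A (fun p : G * G => (p.1 * p.2)%g) &
      smooth A A (fun x : G => (x^-1)%g)].

(* The Lie algebra is T_1 G, i.e. the model space [g] read through [A 1]. *)
Definition Ad (x : G) (eta : g) : g :=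
  tmap A A (fun y : G => (x * y * x^-1)%g) 1%g eta.

(* [xi, eta] = T_1 Ad (xi) (eta) *)
Definition bracket (xi eta : g) : g :=
  tmap A (@flat R g) (Ad^~ eta) 1%g xi.

Definition is_exponential (expG : g -> G) : Prop :=
  forall xi, let c (t : R^o) := expG (t *: xi) in
  [/\ smooth (@flat R R^o) A c,
      forall s t, c (s + t) = (c s * c t)%g &
      velocity A c 0 = xi].

End LieGroups.

Section Geometry.
Context {R : realType} {M : topologicalType} {E : tvsType R}.
Context (A : atlas M E).

Section Symplectic.
Context (omega : M -> E -> E -> R).

Definition form_in_chart (c : chart M E) (x u v : E) : R :=
  omega (param c x) (tmap (@flat R E) A (param c) x u)
                    (tmap (@flat R E) A (param c) x v).

Definition smooth_form : Prop := forall n,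
  smooth_on (F := R^o) (cod (A n) `*` [set: E * E])
    (fun p : E * (E * E) => form_in_chart (A n) p.1 p.2.1 p.2.2).

Definition closed_form : Prop := forall n x u v w, cod (A n) x ->
  let d (X Y Z : E) : R :=
    gderive (fun y => form_in_chart (A n) y Y Z : R^o) x X in
  d u v w + d v w u + d w u v = 0.

Definition symplectic_form : Prop :=
  [/\ forall m Y, scalar (omega m ^~ Y),
      forall m X Y, omega m X Y = - omega m Y X,
      smooth_form,
      closed_form &
      forall m X, (forall Y, omega m X Y = 0) -> X = 0].

End Symplectic.

Definition almost_complex (j : M -> E -> E) : Prop :=
  [/\ forall m, linear (j m),
      forall n, smooth_on (cod (A n) `*` [set: E])
        (fun p : E * E => let q := param (A n) p.1 in
           tmap A (@flat R E) (coord (A n)) q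
             (j q (tmap (@flat R E) A (param (A n)) p.1 p.2))) &
      forall m X, j m (j m X) = - X].

Definition compatible (omega : M -> E -> E -> R) (j : M -> E -> E) : Prop :=
  (forall m X Y, omega m (j m X) (j m Y) = omega m X Y) /\
  (forall m X, X != 0 -> 0 < omega m X (j m X)).

Section Action.
Context {G : preTopologicalGroupType} {g : tvsType R} (AG : atlas G g).
Context (expG : g -> G) (Ups : G -> M -> M).

Definition smooth_left_action : Prop :=
  [/\ forall m, Ups 1%g m = m,
      forall x y m, Ups (x * y)%g m = Ups x (Ups y m) &
      smooth (prod_atlas AG A) A (fun p : G * M => Ups p.1 p.2)].

Definition symplectic_action (omega : M -> E -> E -> R) : Prop :=
  smooth_left_action /\
  forall x m X Y, omega (Ups x m) (tmap A A (Ups x) m X) (tmap A A (Ups x) m Y)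
    = omega m X Y.

Definition inf_action (xi : g) (m : M) : E :=
  velocity A (fun t : R^o => Ups (expG (t *: xi)) m) 0.

Definition stabilizer (m : M) : set g := [set xi | inf_action xi m = 0].

Definition tau (j : M -> E -> E) (x : G) (m : M) (X : E) : E :=
  tmap A A (Ups x) (Ups x^-1%g m)
    (j (Ups x^-1%g m) (tmap A A (Ups x^-1%g) m X)) - j m X.

Definition tau' (j : M -> E -> E) (xi : g) (m : M) (X : E) : E :=
  gderive (fun t : R^o => tau j (expG (t *: xi)) m X) 0 1.

Definition momentum_map (omega : M -> E -> E -> R) (kappa : g -> g -> R)
    (J : M -> g) : Prop :=
  smooth A (@flat R g) J /\
  forall m X xi,
    omega m (inf_action xi m) X + kappa (tmap A (@flat R g) J m X) xi = 0.

(* Independent of [m] when [J] is a momentum map and [M] is connected. *)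
Definition cocycle (omega : M -> E -> E -> R) (kappa : g -> g -> R)
    (J : M -> g) (m : M) (xi eta : g) : R :=
  kappa (J m) (bracket AG xi eta)
    + omega m (inf_action xi m) (inf_action eta m).

End Action.
End Geometry.

Section Pairing.
Context {R : realType} {g : lmodType R}.

Definition inner_pairing (kappa : g -> g -> R) : Prop :=
  [/\ forall eta, scalar (kappa ^~ eta),
      forall xi eta, kappa xi eta = kappa eta xi,
      forall xi, (forall eta, kappa xi eta = 0) -> xi = 0 &
      forall xi, xi != 0 -> 0 < kappa xi xi].

End Pairing.

(* V (+) iV, with (x, y) standing for x + iy *)
Definition complexification {R : realType} (V : lmodType R) : Type :=
  (V * V)%type.

Section Complexification.
Context {R : realType} {V : lmodType R}.
Local Notation VC := (complexification V).

HB.instance Definition _ := GRing.Zmodule.on VC.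

Definition cscale (a : R[i]) (z : VC) : VC :=
  (complex.Re a *: z.1 - complex.Im a *: z.2,
   complex.Re a *: z.2 + complex.Im a *: z.1).

Let cscaleA a b z : cscale a (cscale b z) = cscale (a * b) z.
Proof.
case: a b z => [a a'] [b b'] [x y]; congr pair => /=.
  rewrite !scalerBr !scalerDr !scalerBl !scalerDl !scalerA !opprD -!addrA.
  by congr (_ + _); rewrite [RHS]addrC -[RHS]addrA.
rewrite !scalerBr !scalerDr !scalerBl !scalerDl !scalerA -!addrA.
by congr (_ + _); rewrite [RHS]addrC -[RHS]addrA.
Qed.

Let cscale1 : left_id 1 cscale.
Proof. by case=> x y; rewrite /cscale /= !scale1r !scale0r subr0 addr0. Qed.

Let cscaleDr : right_distributive cscale +%R.
Proof.
case=> [a a'] [x y] [x' y']; congr pair => /=; rewrite ?scalerDr.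
  by rewrite opprD addrACA.
by rewrite addrACA.
Qed.

Let cscaleDl z : {morph cscale^~ z : a b / a + b}.
Proof.
case: z => x y [a a'] [b b']; congr pair => /=; rewrite !scalerDl.
  by rewrite opprD addrACA.
by rewrite addrACA.
Qed.

HB.instance Definition _ :=
  GRing.Zmodule_isLmodule.Build R[i] VC cscaleA cscale1 cscaleDr cscaleDl.

Definition real_part_embed (x : V) : VC := (x, 0).

Definition hermitian_ext (kappa : V -> V -> R) (z w : VC) : R[i] :=
  ((kappa z.1 w.1 + kappa z.2 w.2) +i* (kappa z.2 w.1 - kappa z.1 w.2))%C.

Definition bilinear_ext (br : V -> V -> V) (z w : VC) : VC :=
  (br z.1 w.1 - br z.2 w.2, br z.1 w.2 + br z.2 w.1).

End Complexification.

Section WeightSpaces.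
Context {R : realType} {g : lmodType R}.
Local Notation gC := (complexification g).
Context (br : g -> g -> g).

Definition abelian_subalgebra (t : set g) : Prop :=
  is_subspace t /\ forall mu nu, t mu -> t nu -> br mu nu = 0.

Definition invariant_pairing (kappa : g -> g -> R) (t : set g) : Prop :=
  forall mu xi eta, t mu -> kappa (br mu xi) eta + kappa xi (br mu eta) = 0.

(* The algebraic dual of [t]. *)
Definition dual_space (t : set g) : set (t -> R) :=
  [set lambda | forall (a : R) (mu nu rho : t),
    \val rho = a *: \val mu + \val nu ->
    lambda rho = a * lambda mu + lambda nu].

Context (t : set g) (S : set gC).

Definition commuting_part : set gC :=
  [set zeta | S zeta /\
    forall mu, t mu -> bilinear_ext br (real_part_embed mu) zeta = 0].

Definition weight_space (lambda : t -> R) : set gC :=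
  [set zeta | S zeta /\ forall mu : t,
    'i%C *: bilinear_ext br (real_part_embed (\val mu)) zeta
      = (lambda mu)%:C%C *: zeta].

Definition nonzero_weights : set (t -> R) :=
  [set lambda | [/\ dual_space lambda, lambda != 0 &
    exists2 zeta, weight_space lambda zeta & zeta != 0]].

End WeightSpaces.

Section ComplexStabilizer.
Context {R : realType} {M : topologicalType} {E : tvsType R} (A : atlas M E).
Context {G : preTopologicalGroupType} {g : tvsType R}.
Context (expG : g -> G) (Ups : G -> M -> M) (j : M -> E -> E).

Definition complex_inf_action (zeta : complexification g) (m : M) : E :=
  inf_action A expG Ups zeta.1 m + j m (inf_action A expG Ups zeta.2 m).

Definition complex_stabilizer (m : M) : set (complexification g) :=
  [set zeta | complex_inf_action zeta m = 0].

End ComplexStabilizer.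

(* Main.v *)
(* For [mu] in [t] the flow of [mu] fixes [m] (near time 0), so its differential
   at [m] is a curve [D_t] of automorphisms of [T_m M]; let [L] be its derivative
   at [t = 0]. Differentiating [D_t (xi . m) = (Ad (exp (t mu)) xi) . m] gives
   [[mu, xi] . m = L (xi . m)], and the invariance of [j_m] says that [L]
   commutes with [j_m]. Hence [ad mu] preserves the complex stabilizer. There the
   operators [i ad mu] commute (Jacobi identity) and are Hermitian for [kappa_C]
   (invariance of [kappa]), and since the complex stabilizer is finite-dimensional
   they are simultaneously diagonalizable with real eigenvalues. *)

Require Import Defs.
From mathcomp Require Import all_boot all_order all_algebra.
From mathcomp Require Import all_classical all_reals all_analysis.
From mathcomp Require Import complex ring.

Set Implicit Arguments.
Unset Strict Implicit.
Unset Printing Implicit Defensive.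

Import Order.TTheory GRing.Theory Num.Theory.
Import numFieldNormedType.Exports.

Local Open Scope classical_set_scope.
Local Open Scope ring_scope.

Local Notation coord := Defs.coord.

(** Two obstacles shape the analytic half. [gderive] is a bare choice of a limit, so linearity of
    derivatives and the chain rule have to be earned: a mean value principle for convex sets
    upgrades C^1 to [strong_derivative], from which both follow. And a tangent space is the model
    space read through a chart selected point by point, with no continuity of the selection, so the
    tangent map of f_p at m may jump with p unless f_p(m) stays put. Conjugation fixes 1, and the
    flow of [mu] fixes m for small times; exactly these two families are differentiated, giving the
    bracket and L. That the flow fixes m is itself a mean value argument, carried out in the chart
    at m. The Jacobi identity comes from differentiating the fact that each [Ad x] preserves the
    bracket. On the algebraic side the commuting family is indexed by all of t. Common eigenvectors
    are found by induction on a dimension bound; an eigenvalue is at first only a function on t, and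
    its reality and linearity are read off from the eigenvector afterwards. *)

Section LinearMaps.
Context {K : nzRingType} {U V : lmodType K} (L : U -> V) (lL : linear L).

Lemma linear_map0 : L 0 = 0.
Proof. by have := lL (-1) 0 0; rewrite scaler0 addr0 scaleN1r addNr. Qed.

Lemma linear_mapD u v : L (u + v) = L u + L v.
Proof. by have := lL 1 u v; rewrite !scale1r. Qed.

Lemma linear_mapZ a u : L (a *: u) = a *: L u.
Proof. by rewrite -[a *: u]addr0 lL linear_map0 addr0. Qed.

Lemma linear_mapN u : L (- u) = - L u.
Proof. by rewrite -scaleN1r linear_mapZ scaleN1r. Qed.

Lemma linear_mapB u v : L (u - v) = L u - L v.
Proof. by rewrite linear_mapD linear_mapN. Qed.

End LinearMaps.

(** * Calculus in locally convex spaces *)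

Definition convex_comb_closed (R : realType) (F : lmodType R) (U : set F) :=
  forall (a b : R) v w, 0 <= a -> 0 <= b -> a + b = 1 -> U v -> U w ->
    U (a *: v + b *: w).

Lemma convex_nbhs (R : realType) (F : tvsType R) (x : F) (U : set F) :
  nbhs x U -> exists V, [/\ open_nbhs x V, V `<=` U & convex_comb_closed V].
Proof.
move=> xU; have [B convB [openB basisB]] := @locally_convex R F.
have [V [BV Vx] VU] := basisB x U xU.
exists V; split=> //; first by split=> //; exact: openB.
move=> a b v w a0 b0 ab1 Vv Vw.
have a1 : a <= 1 by rewrite -ab1 lerDl.
have := convB V (mem_set BV) v w (Itv01 a0 a1) (mem_set Vv) (mem_set Vw).
have -> : b = 1 - a by rewrite -ab1 addrAC subrr add0r.
by rewrite inE.
Qed.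

Lemma cvgDt (R : realType) (F : tvsType R) (T : Type) (FF : set_system T)
    {fF : Filter FF} (f g : T -> F) (a b : F) :
  f @ FF --> a -> g @ FF --> b -> (fun t => f t + g t) @ FF --> a + b.
Proof.
move=> fa gb; apply: (cvg_comp (fun t => (f t, g t)) (fun p : F * F => p.1 + p.2)
  (cvg_pair fa gb)); exact: (@add_continuous F (a, b)).
Qed.

Lemma cvgZt (R : realType) (F : tvsType R) (T : Type) (FF : set_system T)
    {fF : Filter FF} (k : T -> R) (f : T -> F) (l : R) (a : F) :
  k @ FF --> l -> f @ FF --> a -> (fun t => k t *: f t) @ FF --> l *: a.
Proof.
move=> fa gb; apply: (cvg_comp (fun t => (k t : R^o, f t))
  (fun p : R^o * F => p.1 *: p.2)
  (@cvg_pair _ _ _ _ (nbhs (l : R^o)) (nbhs a) _ _ _ _ _ fa gb)).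
exact: (@scale_continuous R F (l : R^o, a)).
Qed.

Lemma near_dnbhs0 (R : realType) (P : R -> Prop) :
  (\forall h \near (0 : R)^', P h) <->
  exists2 d : R, 0 < d & forall h, h != 0 -> `|h| < d -> P h.
Proof.
split.
  rewrite near_withinE => /nbhs_ballP[d /= d0 dP]; exists d => // h h0 hd.
  by apply: dP; rewrite // -ball_normE /= sub0r normrN.
move=> [d d0 dP]; rewrite near_withinE; apply/nbhs_ballP; exists d => //= h.
by rewrite -ball_normE /= sub0r normrN => hd h0; exact: dP.
Qed.

(* The set of [s] such that every slope [(c s' - c 0) / s'], [0 < s' <= s], lies
   in [U] is closed under passing to its supremum and slightly beyond, since [U]
   is convex: no closedness of [U] and no Hahn-Banach theorem is needed. *)
Lemma convex_mean_value (R : realType) (F : lmodType R) (c : R -> F) (U : set F) :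
  convex_comb_closed U ->
  (forall s : R, 0 <= s -> s <= 1 ->
    \forall h \near (0 : R)^', U (h^-1 *: (c (h + s) - c s))) ->
  U (c 1 - c 0).
Proof.
move=> cU dc.
pose sl a b := (b - a)^-1 *: (c b - c a).
have step (a b : R) : 0 <= a -> a < b -> (a = 0 \/ U (sl 0 a)) ->
    U (sl a b) -> U (sl 0 b).
  move=> a0 ab U1 U2.
  have b0 : 0 < b by exact: le_lt_trans ab.
  have [a00|an0] := eqVneq a 0; first by rewrite -a00.
  suff -> : sl 0 b = (a / b) *: sl 0 a + ((b - a) / b) *: sl a b.
    apply: cU => //; first exact: divr_ge0 (ltW _).
      by rewrite divr_ge0 // ?subr_ge0 ltW.
      by rewrite -mulrDl addrC subrK divff ?gt_eqF.
    by case: U1 => // a00; rewrite a00 eqxx in an0.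
  rewrite /sl !scalerA !subr0.
  have -> : a / b / a = b^-1 by rewrite mulrAC divff // mul1r.
  have -> : (b - a) / b / (b - a) = b^-1.
    by rewrite mulrAC divff ?mul1r // subr_eq0 gt_eqF.
  by rewrite -scalerDr; congr (_ *: _); rewrite [RHS]addrC addrA subrK.
(* The hypothesis at [s] covers increments of both signs, hence slopes on either side of [s]. *)
have loc (s : R) : 0 <= s -> s <= 1 -> exists2 d : R, 0 < d &
    forall b : R, b != s -> `|b - s| < d -> if b < s then U (sl b s) else U (sl s b).
  move=> s0 s1; have /near_dnbhs0[d d0 dP] := dc s s0 s1; exists d => // b bs bd.
  have := dP (b - s); rewrite subr_eq0 => /(_ bs bd); rewrite subrK.
  case: ifPn => // _; rewrite /sl -(opprB s b) invrN scaleNr -scalerN opprB.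
  by [].
pose A := [set s : R | [/\ 0 <= s, s <= 1 &
  forall s' : R, 0 < s' -> s' <= s -> U (sl 0 s')]].
have A0 : A 0.
  by split=> // s' s'0; rewrite leNgt s'0.
have ubA : ubound A 1 by move=> s [].
have hsA : has_sup A by split; [exists 0|exists 1].
set S := sup A.
have S0 : 0 <= S by apply: ub_le_sup => //; exists 1.
have S1 : S <= 1 by apply: ge_sup => //; exists 0.
have [d d0 dP] := loc S S0 S1.
have below (s' : R) : 0 < s' -> s' < S -> U (sl 0 s').
  move=> s'0 s'S; have Ss' : 0 < S - s' by rewrite subr_gt0.
  have [a [a0 a1 aP]] := sup_adherent Ss' hsA.
  by rewrite -/S opprB addrC subrK => /ltW; exact: aP.
have US : S = 0 \/ U (sl 0 S).
  have [->|Sn0] := eqVneq S 0; [by left|right].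
  have Sgt0 : 0 < S by rewrite lt_neqAle eq_sym Sn0.
  (* Any point of (0, S) closer than [d] to [S] serves: [S / 2] keeps it positive, [S - d / 2] keeps
     it close. *)
  pose a := Num.max (S / 2) (S - d / 2).
  have aS : a < S by rewrite gt_max ltr_pdivrMr // ltr_pMr ?ltr1n // ltrBlDr ltrDl divr_gt0.
  have a0 : 0 < a by rewrite lt_max divr_gt0.
  apply: (step a) => //; [exact: ltW|by right; exact: below|].
  have := dP a; rewrite lt_eqF // aS; apply => //.
  rewrite ltr0_norm ?subr_lt0 // opprB ltrBlDl -ltrBlDr.
  rewrite lt_max; apply/orP; right.
  by rewrite ltrD2l ltrN2 ltr_pdivrMr // ltr_pMr // ltr1n.
have above (s' : R) : 0 < s' -> s' < S + d -> U (sl 0 s').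
  move=> s'0 s'd; have [?|s'S|s'S] := ltgtP s' S; first exact: below.
    apply: (step S) => //.
    have := dP s'; rewrite gt_eqF // (ltNge s') (ltW s'S) /=; apply => //.
    by rewrite gtr0_norm ?subr_gt0 // ltrBlDl.
  by rewrite s'S; case: US => // S00; move: s'0; rewrite s'S S00 ltxx.
have : 1 < S + d.
  rewrite ltNge; apply/negP => Sd1.
  have : A (S + d / 2).
    have Sd2 : S + d / 2 < S + d by rewrite ltrD2l ltr_pdivrMr // ltr_pMr // ltr1n.
    split; first by rewrite addr_ge0 // divr_ge0 // ltW.
      exact: le_trans (ltW Sd2) Sd1.
    by move=> s' s'0 s'd; apply: above => //; exact: le_lt_trans Sd2.
  move=> /(ub_le_sup (ex_intro _ 1 ubA)); rewrite -/S leNgt => /negP; apply.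
  by rewrite ltrDl divr_gt0.
move=> /above; rewrite ltr01 => /(_ isT).
by rewrite /sl subr0 invr1 scale1r.
Qed.

Lemma hausdorff_pair (S T : topologicalType) :
  hausdorff_space S -> hausdorff_space T -> hausdorff_space (S * T)%type.
Proof.
move=> hS hT [x y] [x' y'] cl; congr pair.
  apply: hS => A B xA x'B.
  have [||[u v] [[/= Au _] [Bu _]]] := cl (A `*` setT) (B `*` setT).
  - by exists (A, setT) => //; split=> //; exact: filterT.
  - by exists (B, setT) => //; split=> //; exact: filterT.
  by exists u.
apply: hT => A B yA y'B.
have [||[u v] [[/= _ Av] [_ Bv]]] := cl (setT `*` A) (setT `*` B).
- by exists (setT, A) => //; split=> //; exact: filterT.
- by exists (setT, B) => //; split=> //; exact: filterT.
by exists v.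
Qed.

Lemma open_setX (S T : topologicalType) (U : set S) (V : set T) :
  open U -> open V -> open (U `*` V).
Proof.
rewrite !openE => oU oV [x y] [/= Ux Vy].
by exists (U, V) => //; split; [exact: oU|exact: oV].
Qed.

Lemma continuous_pair (S T U : topologicalType) (f : S -> T) (g : S -> U) x :
  {for x, continuous f} -> {for x, continuous g} ->
  {for x, continuous (fun y => (f y, g y))}.
Proof. by move=> cf cg; exact: cvg_pair cf cg. Qed.

Section StrongDerivative.
Context {R : realType}.
Implicit Types E F H : tvsType R.

Lemma line_pair E F (h : R) (v x : E) (w y : F) :
  h *: ((v, w) : E * F) + (x, y) = (h *: v + x, h *: w + y).
Proof. by []. Qed.

Lemma cvg_line E (x v : E) : (h *: v + x) @[h --> (0 : R)^'] --> x.
Proof.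
rewrite -[X in _ --> X]add0r -(scale0r v).
apply: cvgDt; last exact: cvg_cst.
apply: cvgZt; last exact: cvg_cst.
exact: nbhs_dnbhs.
Qed.

Lemma gderive_cvg E F (f : E -> F) x v : gderivable f x v ->
  quotient_at f x v h @[h --> (0 : R)^'] --> gderive f x v.
Proof. by move=> fxv; rewrite /gderive; exact: (xgetPex 0 fxv). Qed.

Lemma gderive_eq E F (f : E -> F) x v (l : F) : hausdorff_space F ->
  quotient_at f x v h @[h --> (0 : R)^'] --> l -> gderive f x v = l.
Proof.
move=> hF fl; apply: (cvg_unique hF (F := quotient_at f x v @ (0 : R)^')) => //.
by apply: gderive_cvg; exists l.
Qed.

Lemma quotient_at_near E F (f g : E -> F) x v :
  (\forall y \near x, f y = g y) ->
  \forall h \near (0 : R)^', quotient_at f x v h = quotient_at g x v h.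
Proof.
move=> fg; near=> h.
have e : f (h *: v + x) = g (h *: v + x) by near: h; exact: (cvg_line v fg).
by rewrite /quotient_at e (nbhs_singleton fg).
Unshelve. all: by end_near.
Qed.

Lemma cvg_near_eq (T : Type) (S : nbhsType) (FF : set_system T) {fF : Filter FF}
    (f g : T -> S) (l : S) :
  (\forall t \near FF, f t = g t) -> f @ FF --> l -> g @ FF --> l.
Proof.
move=> fg fl U /fl; apply: filterS2 fg => t /= ->; exact.
Qed.

Lemma quotient_at_near_cvg E F (f g : E -> F) x v (l : F) :
  (\forall y \near x, f y = g y) ->
  quotient_at f x v h @[h --> (0 : R)^'] --> l ->
  quotient_at g x v h @[h --> (0 : R)^'] --> l.
Proof. by move=> fg; apply: cvg_near_eq; exact: quotient_at_near. Qed.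

Lemma gderive_near E F (f g : E -> F) x v :
  (\forall y \near x, f y = g y) -> gderive f x v = gderive g x v.
Proof.
move=> fg; rewrite /gderive; congr (xget 0); apply/seteqP; split=> l /=.
  exact: quotient_at_near_cvg.
by apply: quotient_at_near_cvg; apply: filterS fg.
Qed.

(* The base point and the direction vary together with the step; additivity of the
   derivative and the chain rule are then mere limits of quotients. *)
Definition strong_derivative E F (f : E -> F) (y w : E) (l : F) :=
  (fun q : R * (E * E) => q.1^-1 *: (f (q.1 *: q.2.2 + q.2.1) - f q.2.1))
    @ filter_prod (0 : R)^' (nbhs (y, w)) --> l.

Lemma strong_derivative_cvg E F (f : E -> F) y w l (T : Type) (FF : set_system T)
    {fF : Filter FF} (h : T -> R) (y_ w_ : T -> E) :
  strong_derivative f y w l ->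
  h @ FF --> (0 : R)^' -> y_ @ FF --> y -> w_ @ FF --> w ->
  (fun t => (h t)^-1 *: (f (h t *: w_ t + y_ t) - f (y_ t))) @ FF --> l.
Proof.
move=> fl h0 yy ww.
exact: (cvg_comp _ _ (cvg_pair h0 (cvg_pair yy ww)) fl).
Qed.

Lemma strong_derivative_quotient E F (f : E -> F) y w (l : F) :
  strong_derivative f y w l -> quotient_at f y w h @[h --> (0 : R)^'] --> l.
Proof.
by move=> fl; apply: (strong_derivative_cvg fl);
  [exact: cvg_id|exact: cvg_cst|exact: cvg_cst].
Qed.

(** Along the segment from y' to y' + h w', the rescaled curve [c] has as derivative the one of [f]
    at an intermediate point in direction w'. By joint continuity it lies in a convex neighbourhood
    [V] of the limit once h, y', w' are close to 0, y, w, and the mean value principle puts the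
    quotient itself into [V]. *)
Lemma C1_strong_derivative E F (U : set E) (f : E -> F) y w :
  open U -> Ck_on 1 U f -> U y -> strong_derivative f y w (gderive f y w).
Proof.
move=> oU [_ [df cdf]] Uy W lW.
have [V [ [oV Vl] VW cV]] := convex_nbhs lW.
pose z (k : R) (p : E * E) : E := k *: p.2 + p.1.
have zcvg : (fun q : R^o * (E * E) => z q.1 q.2) @ (0 : R^o, (y, w)) --> y.
  rewrite -[X in _ --> X]add0r -(scale0r w).
  apply: (@cvgDt _ _ _ _ _ (fun q : R^o * (E * E) => q.1 *: q.2.2)).
    apply: (@cvgZt _ _ _ _ _ (fst : R^o * (E * E) -> R^o)); first exact: cvg_fst.
    apply: (cvg_comp snd snd (G := nbhs (y, w))); exact: cvg_snd.
  by apply: (cvg_comp snd fst (G := nbhs (y, w))); [exact: cvg_snd|exact: cvg_fst].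
have N : \forall q \near nbhs (0 : R^o, (y, w)),
    U (z q.1 q.2) /\ V (gderive f (z q.1 q.2) q.2.2).
  near=> q; split; near: q; first by apply: zcvg; exact: open_nbhs_nbhs.
  have : (fun q : R^o * (E * E) => (z q.1 q.2, q.2.2)) @ (0 : R^o, (y, w)) --> (y, w).
    apply: cvg_pair => //=.
    apply: (cvg_comp snd snd (G := nbhs (y, w))); exact: cvg_snd.
  move=> /cvg_comp /(_ (cdf.1 (y, w) _)) /=; apply; first by split.
  exact: open_nbhs_nbhs.
case: N => [ [A B] /= [A0 Byw] AB].
have /nbhs_ballP[d /= d0 dA] := A0.
exists ([set h | h != 0 /\ `|h| < d], B).
  split=> //=; apply/near_dnbhs0; exists d => // h h0 hd.
move=> [h [y' w']] /= [ [h0 hd] Bp]; apply: VW.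
pose c (s : R) := h^-1 *: f ((s * h) *: w' + y').
have -> : h^-1 *: (f (h *: w' + y') - f y') = c 1 - c 0.
  by rewrite /c mul1r mul0r scale0r add0r scalerBr.
apply: convex_mean_value => // s s0 s1.
have sAB : (A `*` B) (s * h : R^o, (y', w')).
  split=> //=; apply: dA; rewrite -ball_normE /= sub0r normrN normrM.
  by rewrite (le_lt_trans _ hd) // ler_piMl // ger0_norm.
have [Uz Vz] := AB _ sAB; rewrite /= in Uz Vz.
have /near_dnbhs0[e e0 eP] := gderive_cvg (df _ w' Uz) (open_nbhs_nbhs (conj oV Vz)).
(* A step [k] of [c] moves the argument of [f] by the multiple [k * h] of w', whence the division by
   the modulus of [h]. *)
apply/near_dnbhs0; exists (e / `|h|); first by rewrite divr_gt0 ?normr_gt0.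
move=> k k0; rewrite ltr_pdivlMr ?normr_gt0 // -normrM => ke.
have := eP (k * h); rewrite mulf_neq0 // => /(_ isT ke).
rewrite /quotient_at /z /= addrA -scalerDl -mulrDl /c -scalerBr scalerA.
by rewrite invfM.
Unshelve. all: by end_near.
Qed.

Lemma cvg_mulr_dnbhs (a : R) : a != 0 -> (h * a) @[h --> (0 : R)^'] --> (0 : R)^'.
Proof.
move=> a0 P /near_dnbhs0[d d0 dP]; apply/near_dnbhs0.
exists (d / `|a|); first by rewrite divr_gt0 ?normr_gt0.
move=> h h0; rewrite ltr_pdivlMr ?normr_gt0 // -normrM; apply: dP.
by rewrite mulf_neq0.
Qed.

(** Writing f(h v + x) as f x + h q, with q the difference quotient of [f], turns the quotient of
    [g \o f] into one of [g] at [f x] in the varying direction q, which the strong derivative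
    permits. *)
Lemma quotient_at_comp E F H (f : E -> F) (g : F -> H) x v (l : F) (k : H) :
  quotient_at f x v h @[h --> (0 : R)^'] --> l -> strong_derivative g (f x) l k ->
  quotient_at (g \o f) x v h @[h --> (0 : R)^'] --> k.
Proof.
move=> fl gk.
apply: (cvg_near_eq _ (strong_derivative_cvg gk cvg_id (cvg_cst (f x)) fl)).
near=> h.
have h0 : h != 0 by near: h; exact: nbhs_dnbhs_neq.
by rewrite /quotient_at /= scalerA divff // scale1r subrK.
Unshelve. all: by end_near.
Qed.

Lemma quotient_at0 E F (f : E -> F) x :
  quotient_at f x 0 h @[h --> (0 : R)^'] --> (0 : F).
Proof.
rewrite (_ : quotient_at f x 0 = fun=> 0); first exact: cvg_cst.
by apply/funext => h; rewrite /quotient_at scaler0 add0r subrr scaler0.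
Qed.

(** Additivity splits the increment at h v + y; this point tends to y, so the strong derivative
    handles the part that starts there. Homogeneity rescales the step, with [a = 0] treated
    apart. *)
Lemma gderive_linear E F (U : set E) (f : E -> F) y : hausdorff_space F ->
  open U -> Ck_on 1 U f -> U y -> linear (gderive f y).
Proof.
move=> hF oU cf Uy a u v; apply: gderive_eq => //.
have D w := C1_strong_derivative (w := w) oU cf Uy.
have -> : quotient_at f y (a *: u + v) = fun h =>
    h^-1 *: (f (h *: (a *: u) + (h *: v + y)) - f (h *: v + y))
      + quotient_at f y v h.
  apply/funext => h; rewrite /quotient_at -scalerDr addrA subrK.
  by rewrite (scalerDr h) -addrA.
apply: cvgDt; last exact: strong_derivative_quotient.
have -> : a *: gderive f y u = gderive f y (a *: u).
  apply/esym; apply: gderive_eq => //.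
  have [->|a0] := eqVneq a 0; first by rewrite !scale0r; exact: quotient_at0.
  have -> : quotient_at f y (a *: u) =
      fun h => a *: ((h * a)^-1 *: (f ((h * a) *: u + y) - f y)).
    by apply/funext => h; rewrite /quotient_at !scalerA invfM mulrCA divff // mulr1.
  apply: cvgZt; first exact: cvg_cst.
  apply: (strong_derivative_cvg (D u)); [exact: cvg_mulr_dnbhs|exact: cvg_cst..].
apply: (strong_derivative_cvg (D _)); first exact: cvg_id.
  exact: cvg_line.
exact: cvg_cst.
Qed.

End StrongDerivative.

Section Smoothness.
Context {R : realType}.
Implicit Types E F H : tvsType R.

Lemma Ck_onS k E F (U : set E) (f : E -> F) : Ck_on k.+1 U f -> Ck_on k U f.
Proof.
elim: k E F U f => [|k IH] E F U f [cf [df ddf]]; first by split.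
by split=> //; split=> //; exact: IH.
Qed.

Lemma Ck_on_continuous k E F (U : set E) (f : E -> F) x :
  Ck_on k U f -> U x -> {for x, continuous f}.
Proof. by case: k => [|k] [cf _]; exact: cf. Qed.

Lemma Ck_on_sub k E F (U V : set E) (f : E -> F) :
  V `<=` U -> Ck_on k U f -> Ck_on k V f.
Proof.
elim: k E F U V f => [|k IH] E F U V f VU [cf df].
  by split=> // x /VU; exact: cf.
split=> [x /VU|]; first exact: cf.
split=> [x v /VU Ux|]; first by case: df => + _; apply.
by apply: IH df.2 => p [/= /VU].
Qed.

Lemma gderivable_near E F (f g : E -> F) x v :
  (\forall y \near x, f y = g y) -> gderivable f x v -> gderivable g x v.
Proof. by move=> fg [l fl]; exists l; exact: quotient_at_near_cvg fl. Qed.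

Lemma continuous_near_eq (S T : topologicalType) (f g : S -> T) x :
  (\forall y \near x, f y = g y) -> {for x, continuous f} ->
  {for x, continuous g}.
Proof.
move=> fg cf; rewrite /prop_for /continuous_at -(nbhs_singleton fg).
exact: cvg_near_eq cf.
Qed.

Lemma Ck_on_ext k E F (U : set E) (f g : E -> F) : open U ->
  (forall x, U x -> f x = g x) -> Ck_on k U f -> Ck_on k U g.
Proof.
have near_fg E' F' (U' : set E') (f' g' : E' -> F') x : open U' ->
    (forall x, U' x -> f' x = g' x) -> U' x -> \forall y \near x, f' y = g' y.
  by move=> oU fg Ux; apply: filterS (open_nbhs_nbhs (conj oU Ux)) => y /fg.
elim: k E F U f g => [|k IH] E F U f g oU fg [cf df]; split=> //.
- by move=> x Ux; apply: continuous_near_eq (cf x Ux); exact: near_fg Ux.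
- by move=> x Ux; apply: continuous_near_eq (cf x Ux); exact: near_fg Ux.
split=> [x v Ux|].
  by apply: gderivable_near (df.1 x v Ux); exact: near_fg Ux.
apply: IH df.2; first exact: open_setX oU openT.
by move=> [x v] [/= Ux _]; apply: gderive_near; exact: near_fg Ux.
Qed.

Lemma quotient_at_linear E F (L : E -> F) x v : linear L ->
  quotient_at L x v h @[h --> (0 : R)^'] --> L v.
Proof.
move=> lL; apply: (cvg_near_eq (f := fun=> L v)); last exact: cvg_cst.
near=> h; have h0 : h != 0 by near: h; exact: nbhs_dnbhs_neq.
by rewrite /quotient_at lL addrK scalerA mulVf // scale1r.
Unshelve. all: by end_near.
Qed.

(** The derivative of [L] is (x, v) |-> L v, again linear and continuous, so the induction on [k]
    ranges over all source spaces. *)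
Lemma Ck_on_linear k E F (U : set E) (L : E -> F) : hausdorff_space F ->
  linear L -> continuous L -> Ck_on k U L.
Proof.
move=> hF; elim: k E U L => [|k IH] E U L lL cL; split=> //.
  by move=> x _; exact: cL.
  by move=> x _; exact: cL.
split=> [x v _|]; first by exists (L v); exact: quotient_at_linear.
rewrite (_ : (fun p => _) = fun p : E * E => L p.2).
  apply: IH => [a p q|p]; first by rewrite /= lL.
  by apply: (@continuous_comp _ _ _ snd L); [exact: cvg_snd|exact: cL].
by apply/funext => p; apply: gderive_eq => //; exact: quotient_at_linear.
Qed.

Lemma quotient_at_cst E F (c : F) (x v : E) :
  quotient_at (fun=> c) x v h @[h --> (0 : R)^'] --> (0 : F).
Proof.
rewrite (_ : quotient_at _ x v = fun=> 0); first exact: cvg_cst.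
by apply/funext => h; rewrite /quotient_at subrr scaler0.
Qed.

Lemma Ck_on_cst k E F (U : set E) (c : F) : hausdorff_space F ->
  Ck_on k U (fun=> c).
Proof.
move=> hF; elim: k E U c => [|k IH] E U c; split=> //.
  by move=> x _; exact: cvg_cst.
  by move=> x _; exact: cvg_cst.
split=> [x v _|]; first by exists 0; exact: quotient_at_cst.
rewrite (_ : (fun p => _) = fun=> 0); first exact: IH.
by apply/funext => p; apply: gderive_eq => //; exact: quotient_at_cst.
Qed.

Lemma quotient_at_pair E F H (f : E -> F) (g : E -> H) x v (l : F) (k : H) :
  quotient_at f x v h @[h --> (0 : R)^'] --> l ->
  quotient_at g x v h @[h --> (0 : R)^'] --> k ->
  quotient_at (fun y => (f y, g y)) x v h @[h --> (0 : R)^'] --> (l, k).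
Proof. by move=> fl gk; exact: cvg_pair fl gk. Qed.

Lemma Ck_on_pair k E F H (U : set E) (f : E -> F) (g : E -> H) :
  hausdorff_space F -> hausdorff_space H -> open U ->
  Ck_on k U f -> Ck_on k U g -> Ck_on k U (fun x => (f x, g x)).
Proof.
move=> hF hH; elim: k E U f g => [|k IH] E U f g oU [cf df] [cg dg]; split=> //.
  by move=> x Ux; apply: cvg_pair; [exact: cf|exact: cg].
  by move=> x Ux; apply: cvg_pair; [exact: cf|exact: cg].
have dfg x v : U x ->
    quotient_at (fun y => (f y, g y)) x v h @[h --> (0 : R)^']
      --> (gderive f x v, gderive g x v).
  by move=> Ux; apply: quotient_at_pair; apply: gderive_cvg;
    [exact: df.1|exact: dg.1].
split=> [x v Ux|]; first by exists (gderive f x v, gderive g x v); exact: dfg.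
have oUT : open (U `*` [set: E]) by exact: open_setX oU openT.
apply: (Ck_on_ext oUT _ (IH _ _ _ _ oUT df.2 dg.2)) => p [/= Up _].
by apply/esym; apply: gderive_eq; [exact: hausdorff_pair|exact: dfg].
Qed.

(** The derivative of [g \o f] is that of [g] composed with (x, v) |-> (f x, df_x v), so the
    induction on [k] ranges over all spaces. Openness of [V] makes the derivative of [g] strong. *)
Lemma Ck_on_comp k E F H (U : set E) (V : set F) (f : E -> F) (g : F -> H) :
  hausdorff_space E -> hausdorff_space F -> hausdorff_space H ->
  open U -> open V ->
  (forall x, U x -> V (f x)) ->
  Ck_on k U f -> Ck_on k V g -> Ck_on k U (g \o f).
Proof.
elim: k E F H U V f g => [|k IH] E F H U V f g hE hF hH oU oV UV cf cg.
  split=> // x Ux; apply: continuous_comp; first exact: cf.1.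
  by apply: cg.1; exact: UV.
have dgf x v : U x -> quotient_at (g \o f) x v h @[h --> (0 : R)^']
    --> gderive g (f x) (gderive f x v).
  move=> Ux; apply: quotient_at_comp; first by apply: gderive_cvg; exact: cf.2.1.
  apply: (C1_strong_derivative oV) (UV _ Ux).
  by split; [exact: cg.1|split; [exact: cg.2.1|split=> // p; exact: Ck_on_continuous cg.2.2]].
split; first by move=> x Ux; apply: continuous_comp; [exact: cf.1|exact: cg.1 (UV _ Ux)].
split=> [x v Ux|].
  by exists (gderive g (f x) (gderive f x v)); exact: dgf.
have oUT : open (U `*` [set: E]) by exact: open_setX oU openT.
apply: (Ck_on_ext oUT (f := (fun q : F * F => gderive g q.1 q.2) \o
    (fun p : E * E => (f p.1, gderive f p.1 p.2)))).
  by move=> p [/= Up _]; apply/esym; apply: gderive_eq => //; exact: dgf.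
apply: (IH _ _ _ _ (V `*` [set: F])) => //.
- exact: hausdorff_pair.
- exact: hausdorff_pair.
- exact: open_setX oV openT.
- by move=> p [/= /UV].
- apply: Ck_on_pair => //; last exact: cf.2.2.
  apply: (IH _ _ _ _ U fst f) => //; last exact: Ck_onS.
  + exact: hausdorff_pair.
  + by move=> p [].
  + by apply: Ck_on_linear => //; move=> p; exact: cvg_fst.
- exact: cg.2.2.
Qed.

End Smoothness.

Section Germs.
Context {R : realType}.
Implicit Types E F H : tvsType R.

Definition Ck_at k E F (f : E -> F) (x : E) : Prop :=
  exists U, [/\ open U, U x & Ck_on k U f].

Lemma Ck_at_near k E F (f g : E -> F) x :
  (\forall y \near x, f y = g y) -> Ck_at k f x -> Ck_at k g x.
Proof.
rewrite {1}/prop_near1 nbhsE => -[V [oV Vx] fg] [U [oU Ux cf]].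
exists (U `&` V); split; [exact: openI|by []|].
apply: (@Ck_on_ext _ _ _ _ _ f); [exact: openI|by move=> y [_ /fg]|].
by apply: Ck_on_sub cf => y [].
Qed.

Lemma Ck_at_continuous k E F (f : E -> F) x :
  Ck_at k f x -> {for x, continuous f}.
Proof. by move=> [U [oU Ux cf]]; exact: Ck_on_continuous cf Ux. Qed.

Lemma Ck_at_linear k E F (L : E -> F) x : hausdorff_space F ->
  linear L -> continuous L -> Ck_at k L x.
Proof.
by move=> hF lL cL; exists setT; split=> //; [exact: openT|exact: Ck_on_linear].
Qed.

Lemma Ck_at_cst k E F (c : F) (x : E) : hausdorff_space F ->
  Ck_at k (fun=> c) x.
Proof. by move=> hF; exists setT; split=> //; [exact: openT|exact: Ck_on_cst]. Qed.

Lemma Ck_at_pair k E F H (f : E -> F) (g : E -> H) x :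
  hausdorff_space F -> hausdorff_space H ->
  Ck_at k f x -> Ck_at k g x -> Ck_at k (fun y => (f y, g y)) x.
Proof.
move=> hF hH [U [oU Ux cf]] [V [oV Vx cg]].
exists (U `&` V); split; [exact: openI|by []|].
apply: Ck_on_pair => //; first exact: openI.
  by apply: Ck_on_sub cf => y [].
by apply: Ck_on_sub cg => y [].
Qed.

Lemma Ck_at_comp k E F H (f : E -> F) (g : F -> H) x :
  hausdorff_space E -> hausdorff_space F -> hausdorff_space H ->
  Ck_at k f x -> Ck_at k g (f x) -> Ck_at k (g \o f) x.
Proof.
move=> hE hF hH [U [oU Ux cf]] [V [oV Vx cg]].
have oW : open (U `&` f @^-1` V).
  rewrite openE => y [Uy Vy]; apply: filterI; first exact: open_nbhs_nbhs.
  by apply: (Ck_on_continuous cf Uy); exact: open_nbhs_nbhs.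
exists (U `&` f @^-1` V); split=> //.
apply: (Ck_on_comp hE hF hH oW oV _ _ cg) => [y []//|].
by apply: Ck_on_sub cf => y [].
Qed.

Lemma Ck_at_strong_derivative E F (f : E -> F) x v :
  Ck_at 1 f x -> strong_derivative f x v (gderive f x v).
Proof. by move=> [U [oU Ux cf]]; exact: C1_strong_derivative cf Ux. Qed.

Lemma Ck_at_gderive_cvg E F (f : E -> F) x v :
  Ck_at 1 f x -> quotient_at f x v h @[h --> (0 : R)^'] --> gderive f x v.
Proof.
by move=> cf; apply: strong_derivative_quotient; exact: Ck_at_strong_derivative.
Qed.

Lemma Ck_at_gderive_linear E F (f : E -> F) x : hausdorff_space F ->
  Ck_at 1 f x -> linear (gderive f x).
Proof. by move=> hF [U [oU Ux cf]]; exact: gderive_linear cf Ux. Qed.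

Lemma Ck_at_gderive k E F (f : E -> F) x v :
  Ck_at k.+1 f x -> Ck_at k (fun p : E * E => gderive f p.1 p.2) (x, v).
Proof.
move=> [U [oU Ux [_ [_ cf]]]]; exists (U `*` [set: E]).
by split=> //; exact: open_setX oU openT.
Qed.

Lemma gderive_comp E F H (f : E -> F) (g : F -> H) x v : hausdorff_space H ->
  Ck_at 1 f x -> Ck_at 1 g (f x) ->
  gderive (g \o f) x v = gderive g (f x) (gderive f x v).
Proof.
move=> hH cf cg; apply: gderive_eq => //.
apply: quotient_at_comp; last exact: Ck_at_strong_derivative cg.
exact: Ck_at_gderive_cvg.
Qed.

End Germs.

(** * Maps between manifolds *)

Section Charts.
Context {R : realType}.

Section OneChart.
Context (M : topologicalType) (E : tvsType R) (c : chart M E).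

Lemma paramK x : cod c x -> coord c (param c x) = x.
Proof. by move=> [m cm <-]; rewrite coordK. Qed.

Lemma near_cod m : dom c m -> \forall x \near coord c m, cod c x.
Proof.
move=> cm; apply: open_nbhs_nbhs; split; first exact: cod_open.
by exists m.
Qed.

Lemma near_dom m : dom c m -> \forall p \near m, dom c p.
Proof. by move=> cm; apply: open_nbhs_nbhs; split=> //; exact: dom_open. Qed.

Lemma param_cvg m : dom c m -> param c @ coord c m --> m.
Proof.
move=> cm; rewrite -[X in _ --> X](coordK cm).
by apply: param_continuous; exists m.
Qed.

End OneChart.

Definition covering_atlas (M : topologicalType) (E : tvsType R) (A : atlas M E) :=
  forall m, dom (A m) m.

Lemma flat_covering (E : tvsType R) : covering_atlas (@flat R E).
Proof. by []. Qed.

Lemma prod_covering (M N : topologicalType) (E F : tvsType R) (A : atlas M E)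
    (B : atlas N F) :
  covering_atlas A -> covering_atlas B -> covering_atlas (prod_atlas A B).
Proof. by move=> cA cB [m n]; split; [exact: cA|exact: cB]. Qed.

Definition local_rep (M N : topologicalType) (E F : tvsType R) (A : atlas M E)
    (B : atlas N F) (f : M -> N) (m : M) : E -> F :=
  coord (B (f m)) \o f \o param (A m).

(** Continuity is listed separately: [coord] is arbitrary off the chart domain, so a regular
    representative alone does not force [f] to map points near [m] into the chart at [f m]. *)
Definition Ck_map k (M N : topologicalType) (E F : tvsType R) (A : atlas M E)
    (B : atlas N F) (f : M -> N) (m : M) : Prop :=
  {for m, continuous f} /\ Ck_at k (local_rep A B f m) (coord (A m) m).

(** The charts need not be those selected at [p] and [f p]: in [stabilizer_fix] a whole piece of an
    orbit is read in the one chart at [m]. *)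
Lemma smooth_Ck_at k (M N : topologicalType) (E F : tvsType R) (A : atlas M E)
    (B : atlas N F) (f : M -> N) m n p :
  smooth A B f -> dom (A m) p -> dom (B n) (f p) ->
  Ck_at k (coord (B n) \o f \o param (A m)) (coord (A m) p).
Proof.
move=> [cf sf] dp dfp; exists (cod (A m) `&` (f \o param (A m)) @^-1` dom (B n)).
split; last exact: sf.
  rewrite openE => x [cx dx]; apply: filterI.
    by apply: open_nbhs_nbhs; split=> //; exact: cod_open.
  have /= := @continuous_comp _ _ _ (param (A m)) f x
    (param_continuous cx) (cf _).
  by apply; exact: near_dom.
by split; [exists p|rewrite /= coordK].
Qed.

Lemma smooth_Ck_map k (M N : topologicalType) (E F : tvsType R) (A : atlas M E)
    (B : atlas N F) (f : M -> N) m :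
  covering_atlas A -> covering_atlas B -> smooth A B f -> Ck_map k A B f m.
Proof.
move=> cA cB sf; split; first exact: sf.1.
exact: smooth_Ck_at.
Qed.

Section Maps.
Context (M N P : topologicalType) (E F H : tvsType R).
Context (A : atlas M E) (B : atlas N F) (C : atlas P H).
Hypotheses (cA : covering_atlas A) (cB : covering_atlas B).
Hypotheses (hE : hausdorff_space E) (hF : hausdorff_space F)
  (hH : hausdorff_space H).

Lemma tmap_linear (f : M -> N) m : Ck_map 1 A B f m -> linear (tmap A B f m).
Proof. by move=> [_ sf]; exact: Ck_at_gderive_linear. Qed.

Lemma tmap_continuous (f : M -> N) m :
  Ck_map 1 A B f m -> continuous (tmap A B f m).
Proof.
move=> [_ sf] v; have := Ck_at_continuous (Ck_at_gderive v sf).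
apply: (@continuous_comp _ _ _ (fun w => (coord (A m) m, w))
  (fun p : E * E => gderive (local_rep A B f m) p.1 p.2) v).
by apply: cvg_pair; [exact: cvg_cst|exact: cvg_id].
Qed.

Lemma Ck_map_pair k (f : M -> N) (g : M -> P) m :
  Ck_map k A B f m -> Ck_map k A C g m ->
  Ck_map k A (prod_atlas B C) (fun p => (f p, g p)) m.
Proof.
move=> [cf sf] [cg sg]; split; first exact: cvg_pair.
exact: Ck_at_pair sf sg.
Qed.

Lemma local_rep_comp (f : M -> N) (g : N -> P) m : {for m, continuous f} ->
  \forall x \near coord (A m) m,
    (local_rep B C g (f m) \o local_rep A B f m) x = local_rep A C (g \o f) m x.
Proof.
move=> cf; near=> x; rewrite /local_rep /= coordK //.
near: x; have df : \forall p \near m, dom (B (f m)) (f p) by apply: cf; exact: near_dom.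
exact: (param_cvg (cA m) df).
Unshelve. all: by end_near.
Qed.

Lemma local_rep_coord (f : M -> N) m :
  local_rep A B f m (coord (A m) m) = coord (B (f m)) (f m).
Proof. by rewrite /local_rep /= coordK. Qed.

Lemma Ck_map_comp k (f : M -> N) (g : N -> P) m :
  Ck_map k A B f m -> Ck_map k B C g (f m) -> Ck_map k A C (g \o f) m.
Proof.
move=> [cf sf] [cg sg]; split; first exact: continuous_comp.
apply: (Ck_at_near (local_rep_comp _ cf)).
by apply: Ck_at_comp => //; rewrite local_rep_coord.
Qed.

Lemma tmap_comp (f : M -> N) (g : N -> P) m X :
  Ck_map 1 A B f m -> Ck_map 1 B C g (f m) ->
  tmap A C (g \o f) m X = tmap B C g (f m) (tmap A B f m X).
Proof.
move=> [cf sf] [cg sg]; rewrite /tmap -/(local_rep _ _ _ _).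
rewrite -(gderive_near _ (local_rep_comp _ cf)) gderive_comp // local_rep_coord //.
Qed.

Lemma Ck_map_id k m : Ck_map k A A id m.
Proof.
split; first exact: cvg_id.
apply: (@Ck_at_near _ _ _ _ id); last by apply: Ck_at_linear => // x; exact: cvg_id.
by apply: filterS (near_cod (cA m)) => x /paramK.
Qed.

Lemma tmap_id m X : tmap A A id m X = X.
Proof.
rewrite /tmap (@gderive_near _ _ _ _ id); last first.
  by apply: filterS (near_cod (cA m)) => x /paramK.
by apply: gderive_eq => //; exact: quotient_at_linear.
Qed.

Lemma Ck_map_cst k (n : N) m : Ck_map k A B (fun=> n) m.
Proof. by split; [exact: cvg_cst|exact: Ck_at_cst]. Qed.

Lemma Ck_map_fst k p : Ck_map k (prod_atlas A B) A fst p.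
Proof.
split; first exact: cvg_fst.
apply: (@Ck_at_near _ _ _ _ fst); last first.
  by apply: Ck_at_linear => // x; exact: cvg_fst.
near=> x; rewrite /local_rep /= paramK //; near: x.
have codA : nbhs (coord (A p.1) p.1) (cod (A p.1)) by exact: near_cod.
exact: (@cvg_fst _ _ (nbhs (coord (A p.1) p.1)) (nbhs (coord (B p.2) p.2)) _ _ codA).
Unshelve. all: by end_near.
Qed.

Lemma Ck_map_snd k p : Ck_map k (prod_atlas A B) B snd p.
Proof.
split; first exact: cvg_snd.
apply: (@Ck_at_near _ _ _ _ snd); last first.
  by apply: Ck_at_linear => // x; exact: cvg_snd.
near=> x; rewrite /local_rep /= paramK //; near: x.
have codB : nbhs (coord (B p.2) p.2) (cod (B p.2)) by exact: near_cod.
exact: (@cvg_snd _ _ (nbhs (coord (A p.1) p.1)) (nbhs (coord (B p.2) p.2)) _ _ codB).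
Unshelve. all: by end_near.
Qed.

End Maps.

End Charts.

(** * Tangent maps depending on a parameter *)

Section TangentFamilies.
Context {R : realType} {P M N : topologicalType} {EP E F : tvsType R}.
Context {AP : atlas P EP} {A : atlas M E} {B : atlas N F}.
Hypothesis cP : covering_atlas AP.
Hypotheses (hEP : hausdorff_space EP) (hE : hausdorff_space E)
  (hF : hausdorff_space F).
Context (f : P * M -> N) (p0 : P) (m0 : M) (n0 : N).
Hypothesis fn0 : \forall p \near p0, f (p, m0) = n0.
Hypothesis Cf : Ck_map 2 (prod_atlas AP A) B f (p0, m0).

(* Since [f (p, m0)] does not depend on [p] near [p0], all these tangent maps are
   read in the same pair of charts, and [family p v] is a partial derivative of
   one local representative of [f]. *)
Local Notation family p := (tmap A B (fun y => f (p, y)) m0).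

Let F0 : EP * E -> F :=
  coord (B n0) \o f \o param (prod_chart (AP p0) (A m0)).

Let F0_Ck : Ck_at 2 F0 (coord (AP p0) p0, coord (A m0) m0).
Proof. by case: Cf => _; rewrite /local_rep (nbhs_singleton fn0). Qed.

Let G (q : EP * E) : F := gderive F0 (q.1, coord (A m0) m0) (0, q.2).

Let family_near : \forall p \near p0,
  family p = fun v => G (coord (AP p0) p, v).
Proof.
near=> p; apply/funext => v.
have fp : f (p, m0) = n0 by near: p.
have dp : dom (AP p0) p by near: p; exact: near_dom.
rewrite /tmap fp /G /gderive /=.
suff -> : quotient_at (coord (B n0) \o (fun y => f (p, y)) \o param (A m0))
    (coord (A m0) m0) v
  = quotient_at F0 (coord (AP p0) p, coord (A m0) m0) (0, v) by [].
apply/funext => h; rewrite /quotient_at /F0 /=.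
by rewrite scaler0 add0r (coordK dp).
Unshelve. all: by end_near.
Qed.

(** Of the two derivatives available for [F0], one is spent on forming [G]; the other remains for
    differentiating in the parameter. *)
Let G_Ck v : Ck_at 1 G (coord (AP p0) p0, v).
Proof.
apply: (@Ck_at_comp _ _ _ _ _
  (fun q : EP * E => ((q.1, coord (A m0) m0), ((0, q.2) : EP * E)))
  (fun q : (EP * E) * (EP * E) => gderive F0 q.1 q.2)) => //.
- exact: hausdorff_pair.
- by apply: hausdorff_pair; exact: hausdorff_pair.
- apply: Ck_at_pair; try exact: hausdorff_pair.
    apply: Ck_at_pair => //; last exact: Ck_at_cst.
    by apply: Ck_at_linear => // x; exact: cvg_fst.
  apply: Ck_at_pair => //; first exact: Ck_at_cst.
  by apply: Ck_at_linear => // x; exact: cvg_snd.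
- exact: Ck_at_gderive.
Qed.

Lemma family_continuous v :
  {for (p0, v), continuous (fun q : P * E => family q.1 q.2)}.
Proof.
apply: (@continuous_near_eq _ _ (fun q : P * E => G (coord (AP p0) q.1, q.2))).
  near=> q; suff -> : family q.1 = fun w => G (coord (AP p0) q.1, w) by [].
  near: q; exact: (@cvg_fst _ _ (nbhs p0) (nbhs v) _ _ family_near).
apply: (@continuous_comp _ _ _
  (fun q : P * E => (coord (AP p0) q.1, q.2)) G (p0, v)).
  apply: cvg_pair => /=; last exact: cvg_snd.
  apply: (@continuous_comp _ _ _ fst (coord (AP p0)) (p0, v)); first exact: cvg_fst.
  exact: Defs.coord_continuous (cP p0).
exact: Ck_at_continuous (G_Ck v).
Unshelve. all: by end_near.
Qed.

Let rep_near v : \forall x \near coord (AP p0) p0,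
  local_rep AP (@flat R F) (fun p => family p v) p0 x = G (x, v).
Proof.
near=> x; rewrite /local_rep /=.
have cx : cod (AP p0) x by near: x; exact: near_cod.
rewrite (_ : family (param (AP p0) x)
  = fun w => G (coord (AP p0) (param (AP p0) x), w)).
  by rewrite paramK.
near: x; exact: (param_cvg (cP p0) family_near).
Unshelve. all: by end_near.
Qed.

Let slice_Ck v : Ck_at 1 (fun x => G (x, v)) (coord (AP p0) p0).
Proof.
apply: (@Ck_at_comp _ _ _ _ _ (fun x => (x, v)) G) => //.
  exact: hausdorff_pair.
apply: Ck_at_pair => //; last exact: Ck_at_cst.
by apply: Ck_at_linear => // x; exact: cvg_id.
Qed.

Lemma family_Ck v : Ck_map 1 AP (@flat R F) (fun p => family p v) p0.
Proof.
split; last first.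
  by apply: Ck_at_near (slice_Ck v); apply: filterS (rep_near v) => x ->.
apply: (@continuous_comp _ _ _ (fun p => (p, v))
  (fun q : P * E => family q.1 q.2) p0); last exact: family_continuous.
by apply: cvg_pair; [exact: cvg_id|exact: cvg_cst].
Qed.

(** In charts this derivative is [gderive G] at the point (p0, v) in direction (w, 0), and [G] is
    C^1 jointly. For conjugation it gives the joint continuity of the bracket. *)
Lemma family_tmap_continuous :
  continuous (fun q : EP * E => tmap AP (@flat R F) (fun p => family p q.2) p0 q.1).
Proof.
have -> : (fun q : EP * E => tmap AP (@flat R F) (fun p => family p q.2) p0 q.1)
    = fun q => gderive G (coord (AP p0) p0, q.2) (q.1, 0).
  apply/funext => -[w v] /=; rewrite /tmap (gderive_near _ (rep_near v)).
  rewrite /gderive.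
  suff -> : quotient_at (fun x => G (x, v)) (coord (AP p0) p0) w
    = quotient_at G (coord (AP p0) p0, v) (w, 0) by [].
  by apply/funext => h; rewrite /quotient_at line_pair scaler0 add0r.
move=> [w v].
apply: (@continuous_comp _ _ _
  (fun q : EP * E => ((coord (AP p0) p0, q.2), ((q.1, 0) : EP * E)))
  (fun q : (EP * E) * (EP * E) => gderive G q.1 q.2) (w, v)).
  apply: continuous_pair.
    by apply: continuous_pair; [exact: cvg_cst|exact: cvg_snd].
  by apply: continuous_pair; [exact: cvg_fst|exact: cvg_cst].
exact: Ck_at_continuous (Ck_at_gderive _ (G_Ck v)).
Qed.

End TangentFamilies.

(** * Derivatives of curves at time 0 and the product rule *)

Section Leibniz.
Context {R : realType} {F H : tvsType R}.

(** A relation rather than a value of [gderive], so that it carries the existence of the limit. *)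
Definition curve_derivative (c : R -> F) (l : F) : Prop :=
  quotient_at (c : R^o -> F) 0 1 h @[h --> (0 : R)^'] --> l.

Lemma curve_derivativeE (c : R -> F) (l : F) :
  curve_derivative c l <->
  (fun h : R => h^-1 *: (c h - c 0)) @ (0 : R)^' --> l.
Proof.
rewrite /curve_derivative (_ : quotient_at _ _ _ = fun h : R => h^-1 *: (c h - c 0)) //.
by apply/funext => h; rewrite /quotient_at addr0 /GRing.scale /= mulr1.
Qed.

End Leibniz.

(** T_h (c h) - T_0 (c 0) splits as (T_h - T_0)(c 0) + T_h (c h - c 0). Linearity moves 1/h inside
    T_h in the second term, which then converges by joint continuity at (0, l). *)
Lemma curve_derivative_leibniz {R : realType} {F H : tvsType R}
    (T : R -> F -> H) (c : R -> F) (k : H) (l : F) :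
  (\forall t \near (0 : R), linear (T t)) ->
  (forall v, {for (0 : R, v), continuous (fun q : R * F => T q.1 q.2)}) ->
  curve_derivative (T^~ (c 0)) k -> curve_derivative c l ->
  curve_derivative (fun t => T t (c t)) (k + T 0 l).
Proof.
move=> lT cT /curve_derivativeE Tk /curve_derivativeE cl.
apply/curve_derivativeE.
apply: (cvg_near_eq (f := fun h : R =>
  h^-1 *: (T h (c 0) - T 0 (c 0)) + T h (h^-1 *: (c h - c 0)))).
  near=> h; have lTh : linear (T h) by near: h; exact: nbhs_dnbhs.
  rewrite (linear_mapZ lTh) -scalerDr (linear_mapB lTh); congr (_ *: _).
  by rewrite addrC addrA subrK.
apply: cvgDt => //.
apply: (cvg_comp _ _ (cvg_pair _ cl) (cT l)).
exact: nbhs_dnbhs.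
Unshelve. all: by end_near.
Qed.

Section CurveDerivatives.
Context {R : realType} {F H : tvsType R}.

Lemma curve_derivative_unique (c : R -> F) l k : hausdorff_space F ->
  curve_derivative c l -> curve_derivative c k -> l = k.
Proof. by move=> hF cl ck; rewrite -(gderive_eq hF cl) (gderive_eq hF ck). Qed.

Lemma curve_derivative_near (c c' : R -> F) l :
  (\forall t \near (0 : R), c t = c' t) ->
  curve_derivative c l -> curve_derivative c' l.
Proof. exact: (@quotient_at_near_cvg _ R^o F c c'). Qed.

Lemma curve_derivative_linear (L : F -> H) (c : R -> F) l :
  linear L -> continuous L -> curve_derivative c l ->
  curve_derivative (L \o c) (L l).
Proof.
move=> lL cL /curve_derivativeE cl; apply/curve_derivativeE.
apply: (cvg_near_eq _ (cvg_comp _ _ cl (cL l))); near=> h.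
by rewrite /= (linear_mapZ lL) (linear_mapB lL).
Unshelve. all: by end_near.
Qed.

Lemma curve_derivative_opp (c : R -> F) l :
  curve_derivative c l -> curve_derivative (fun t => c (- t)) (- l).
Proof.
move=> /curve_derivativeE cl; apply/curve_derivativeE.
have m1 : (-1 : R) != 0 by rewrite oppr_eq0 oner_eq0.
have cN : (fun h : R => (h * -1)^-1 *: (c (h * -1) - c 0)) @ (0 : R)^' --> l.
  exact: cvg_comp (cvg_mulr_dnbhs m1) cl.
rewrite -[X in _ --> X]scaleN1r; apply: (cvg_near_eq (f := fun h : R =>
  -1 *: ((h * -1)^-1 *: (c (h * -1) - c 0)))); last first.
  by apply: cvgZt cN; exact: cvg_cst.
near=> h.
by rewrite scalerA mulrN1 invrN mulN1r opprK oppr0.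
Unshelve. all: by end_near.
Qed.

End CurveDerivatives.

(** * Lie groups and their actions *)

Section LieGroup.
Context {R : realType} {G : preTopologicalGroupType} {g : tvsType R}.
Context (AG : atlas G g) (hg : hausdorff_space g) (lieG : is_lie_group AG).

Local Notation "[ xi , eta ]" := (bracket AG xi eta).

Let conjugation (p : G * G) : G := (p.1 * p.2 * p.1^-1)%g.

Lemma lie_group_covering : covering_atlas AG.
Proof. by case: lieG => -[]. Qed.

Let cG := lie_group_covering.
Let cGG := prod_covering cG cG.
Let hgg : hausdorff_space (g * g)%type := hausdorff_pair hg hg.

Let conjugation_Ck k p : Ck_map k (prod_atlas AG AG) AG conjugation p.
Proof.
case: lieG => _ smul sinv.
have mul_Ck q := smooth_Ck_map k q cGG cG smul.
have inv_Ck x := smooth_Ck_map k x cG cG sinv.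
apply: (Ck_map_comp (B := prod_atlas AG AG) _ _ _ _ _
  (f := fun q : G * G => ((q.1 * q.2)%g, (q.1^-1)%g))
  (g := fun q : G * G => (q.1 * q.2)%g)) => //.
apply: Ck_map_pair => //.
apply: (Ck_map_comp (B := AG) _ _ _ _ _ (f := fst) (g := fun x : G => (x^-1)%g)) => //.
exact: Ck_map_fst.
Qed.

Lemma conj_Ck k x y : Ck_map k AG AG (fun z => (x * z * x^-1)%g) y.
Proof.
apply: (Ck_map_comp (B := prod_atlas AG AG) _ _ _ _ _
  (f := fun z => (x, z)) (g := conjugation)) => //.
by apply: Ck_map_pair => //; [exact: Ck_map_cst|exact: Ck_map_id].
Qed.

#[local] Hint Resolve conj_Ck : core.

Let conj1 (x : G) : (x * 1 * x^-1 = 1)%g.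
Proof. by rewrite mulg1 mulgV. Qed.

Lemma Ad_linear x : linear (Ad AG x).
Proof. exact: tmap_linear. Qed.

Lemma Ad_continuous x : continuous (Ad AG x).
Proof. exact: tmap_continuous. Qed.

Lemma Ad1 eta : Ad AG 1%g eta = eta.
Proof.
rewrite /Ad (_ : (fun y : G => (1 * y * 1^-1)%g) = id) ?tmap_id //.
by apply/funext => y; rewrite mul1g invg1 mulg1.
Qed.

Lemma AdM x y eta : Ad AG (x * y)%g eta = Ad AG x (Ad AG y eta).
Proof.
rewrite {1}/Ad (_ : (fun z : G => (x * y * z * (x * y)^-1)%g) =
  (fun z => (x * z * x^-1)%g) \o (fun z => (y * z * y^-1)%g)); last first.
  by apply/funext => z /=; rewrite invgM !mulgA.
by rewrite (tmap_comp (B := AG)) // conj1.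
Qed.

(** Conjugation by any [x] fixes 1, so [Ad] is a family of tangent maps whose image point does not
    move. *)
Lemma Ad_Ck eta : Ck_map 1 AG (@flat R g) (Ad AG ^~ eta) 1%g.
Proof.
have conj_near : \forall x \near (1%g : G), conjugation (x, 1%g) = 1%g.
  by apply: nearW => x; exact: conj1.
exact: (family_Ck cG hg hg hg conj_near (conjugation_Ck 2 _) eta).
Qed.

Lemma bracket_continuous : continuous (fun p : g * g => [p.1, p.2]).
Proof.
have conj_near : \forall x \near (1%g : G), conjugation (x, 1%g) = 1%g.
  by apply: nearW => x; exact: conj1.
exact: (family_tmap_continuous cG hg hg hg conj_near (conjugation_Ck 2 _)).
Qed.

Lemma bracket_linearl eta : linear (fun xi => [xi, eta]).
Proof. by apply: tmap_linear => //; exact: Ad_Ck. Qed.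

(** Each [Ad x] is linear, hence so is every difference quotient in the second argument, and
    linearity passes to the limit. *)
Lemma bracket_linearr xi : linear (fun eta => [xi, eta]).
Proof.
move=> a u v; apply: gderive_eq => //.
have D w : quotient_at (local_rep AG (@flat R g) (Ad AG ^~ w) 1%g)
    (coord (AG 1%g) 1%g) xi h @[h --> (0 : R)^'] --> [xi, w].
  by apply: Ck_at_gderive_cvg; case: (Ad_Ck w).
pose q w := quotient_at (local_rep AG (@flat R g) (Ad AG ^~ w) 1%g)
  (coord (AG 1%g) 1%g) xi.
apply: (cvg_near_eq (f := fun h => a *: q u h + q v h)); last first.
  by apply: cvgDt (D v); apply: cvgZt (D u); exact: cvg_cst.
near=> h.
rewrite /q /quotient_at /local_rep /= !Ad_linear scalerA mulrC -scalerA -scalerDr.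
congr (_ *: _); rewrite scalerBr opprD -!addrA; congr (_ + _).
by rewrite addrCA.
Unshelve. all: by end_near.
Qed.

Lemma tmap_flat_linear (E F : tvsType R) (L : E -> F) v w :
  hausdorff_space F -> linear L -> tmap (@flat R E) (@flat R F) L v w = L w.
Proof.
by move=> hF lL; apply: gderive_eq => //; exact: quotient_at_linear.
Qed.

(* Both sides are the derivative at [y = 1] of
   [Ad x (Ad y eta) = Ad (x y x^-1) (Ad x eta)]. *)
Lemma Ad_bracket x xi eta : Ad AG x [xi, eta] = [Ad AG x xi, Ad AG x eta].
Proof.
transitivity (tmap AG (@flat R g) (Ad AG x \o Ad AG ^~ eta) 1%g xi).
  rewrite (tmap_comp (B := @flat R g)) //.
  - by rewrite tmap_flat_linear //; exact: Ad_linear.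
  - exact: Ad_Ck.
  - split; first exact: Ad_continuous.
    by apply: Ck_at_linear => //; [exact: Ad_linear|exact: Ad_continuous].
have -> : Ad AG x \o Ad AG ^~ eta =
    Ad AG ^~ (Ad AG x eta) \o (fun y => (x * y * x^-1)%g).
  by apply/funext => y /=; rewrite -!AdM mulgVK.
rewrite (tmap_comp (B := AG)) //; first by rewrite conj1.
by rewrite conj1; exact: Ad_Ck.
Qed.

Section Exponential.
Context (expG : g -> G) (expP : is_exponential AG expG) (mu : g).
Local Notation c := (fun t : R => expG (t *: mu)).

Lemma exp0 : c 0 = 1%g.
Proof.
case: (expP mu) => _ cD _; have := cD 0 0; rewrite addr0 => e.
by apply: (@mulgI _ (c 0)); rewrite mulg1 -e.
Qed.

Lemma expN t : c (- t) = (c t)^-1%g.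
Proof.
case: (expP mu) => _ cD _; apply/esym/mulg1_eq.
by rewrite -cD subrr exp0.
Qed.

Lemma exp_Ck k : Ck_map k (@flat R R^o) AG c 0.
Proof. by case: (expP mu) => sc _ _; exact: smooth_Ck_map. Qed.

Lemma exp_continuous : continuous c.
Proof. by case: (expP mu) => -[cc _] _ _. Qed.

Lemma tmap_exp (M : topologicalType) (E : tvsType R) (A : atlas M E)
    (phi : G -> M) : covering_atlas A -> hausdorff_space E ->
  Ck_map 1 AG A phi 1%g ->
  velocity A (phi \o c : R^o -> M) 0 = tmap AG A phi 1%g mu.
Proof.
move=> cA hE sphi; rewrite /velocity (tmap_comp (B := AG)) //.
- by case: (expP mu) => _ _; rewrite /velocity exp0 => ->.
- exact: exp_Ck.
- by rewrite exp0.
Qed.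

Lemma curve_derivative_exp (F : tvsType R) (phi : G -> F) :
  hausdorff_space F -> Ck_map 1 AG (@flat R F) phi 1%g ->
  curve_derivative (phi \o c) (tmap AG (@flat R F) phi 1%g mu).
Proof.
move=> hF sphi; rewrite -(tmap_exp (@flat_covering R F)) //.
apply: (@Ck_at_gderive_cvg _ R^o F (phi \o c) 0 1).
have [] // : Ck_map 1 (@flat R R^o) (@flat R F) (phi \o c) 0.
by apply: (Ck_map_comp (B := AG)) => //; [exact: exp_Ck|rewrite exp0].
Qed.

End Exponential.

End LieGroup.

Section Jacobi.
Context {R : realType} {G : preTopologicalGroupType} {g : tvsType R}.
Context (AG : atlas G g) (hg : hausdorff_space g) (lieG : is_lie_group AG).
Context (expG : g -> G) (expP : is_exponential AG expG).

Local Notation "[ xi , eta ]" := (bracket AG xi eta).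

Lemma curve_derivative_Ad mu eta :
  curve_derivative (fun t : R => Ad AG (expG (t *: mu)) eta) [mu, eta].
Proof.
exact: (curve_derivative_exp hg lieG expP hg (Ad_Ck hg lieG eta)).
Qed.

Lemma continuous_Ad_exp mu eta :
  {for (0 : R), continuous (fun t : R => Ad AG (expG (t *: mu)) eta)}.
Proof.
apply: (@continuous_comp _ _ _ (fun t : R => expG (t *: mu)) (Ad AG ^~ eta)).
  exact: exp_continuous expP _ _.
by rewrite /prop_for (exp0 expP); case: (Ad_Ck hg lieG eta).
Qed.

(* The derivative along [exp (t mu)] of [Ad_bracket]. *)
Lemma jacobi mu xi eta : [mu, [xi, eta]] = [[mu, xi], eta] + [xi, [mu, eta]].
Proof.
apply: (curve_derivative_unique hg); first exact: curve_derivative_Ad.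
pose x t : g := Ad AG (expG (t *: mu)) xi; pose y t : g := Ad AG (expG (t *: mu)) eta.
have -> : (fun t => Ad AG (expG (t *: mu)) [xi, eta]) = fun t => [x t, y t].
  by apply/funext => t; exact: Ad_bracket.
have x0 : x 0 = xi by rewrite /x (exp0 expP) Ad1.
have y0 : y 0 = eta by rewrite /y (exp0 expP) Ad1.
rewrite -[in X in _ + X]x0.
(* The bracket with the moving element [x t] serves as the family of linear maps; its derivative at
   the fixed vector [y 0] comes from linearity and continuity in the first slot. *)
apply: (curve_derivative_leibniz (T := fun t => bracket AG (x t)) (c := y)).
- by near=> t; exact: bracket_linearr.
- move=> v.
  apply: (@continuous_comp _ _ _ (fun q : R * g => (x q.1, q.2))
    (fun p : g * g => [p.1, p.2]) (0 : R, v)); last exact: bracket_continuous.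
  apply: continuous_pair; last exact: cvg_snd.
  apply: (@continuous_comp _ _ _ fst x (0 : R, v)); first exact: cvg_fst.
  exact: continuous_Ad_exp.
- rewrite y0; apply: (curve_derivative_linear (L := fun w => [w, eta]) (c := x)).
  + exact: bracket_linearl.
  + move=> w; apply: (@continuous_comp _ _ _ (fun w : g => (w, eta))
      (fun p : g * g => [p.1, p.2]) w); last exact: bracket_continuous.
    by apply: continuous_pair; [exact: cvg_id|exact: cvg_cst].
  + exact: curve_derivative_Ad.
- exact: curve_derivative_Ad.
Unshelve. all: by end_near.
Qed.

End Jacobi.

Lemma nbhs0_eq0 {R : realType} {E : tvsType R} (v : E) : hausdorff_space E ->
  (forall U : set E, nbhs (0 : E) U -> U v) -> v = 0.
Proof.
move=> hE v0; apply/esym; apply: hE => U V U0 Vv; exists v.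
by split; [exact: v0|exact: nbhs_singleton].
Qed.

(** * Smooth actions, flows fixing a point, and the isotropy operator *)

Section Action.
Context {R : realType} {M : topologicalType} {E : tvsType R}.
Context (A : atlas M E) (cA : covering_atlas A) (hE : hausdorff_space E).
Context {G : preTopologicalGroupType} {g : tvsType R}.
Context (AG : atlas G g) (hg : hausdorff_space g) (lieG : is_lie_group AG).
Context (expG : g -> G) (expP : is_exponential AG expG).
Context (Ups : G -> M -> M) (actP : smooth_left_action A AG Ups).

Local Notation cG := (lie_group_covering lieG).

Let action_Ck k p : Ck_map k (prod_atlas AG A) A (fun p : G * M => Ups p.1 p.2) p.
Proof.
by case: actP => _ _; apply: smooth_Ck_map => //; exact: prod_covering cG cA.
Qed.

Let action1 m : Ups 1%g m = m.
Proof. by case: actP. Qed.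

Let actionM x y m : Ups (x * y)%g m = Ups x (Ups y m).
Proof. by case: actP. Qed.

Lemma orbit_Ck k m x : Ck_map k AG A (Ups ^~ m) x.
Proof.
apply: (Ck_map_comp (B := prod_atlas AG A) _ _ _ _ _
  (f := fun x => (x, m)) (g := fun p : G * M => Ups p.1 p.2)) => //.
- exact: cG.
- exact: prod_covering cG cA.
- exact: hausdorff_pair.
- by apply: Ck_map_pair => //; [exact: Ck_map_id cG hg _ _|exact: Ck_map_cst].
Qed.

Lemma translation_Ck k x m : Ck_map k A A (Ups x) m.
Proof.
apply: (Ck_map_comp (B := prod_atlas AG A) _ _ _ _ _
  (f := fun m => (x, m)) (g := fun p : G * M => Ups p.1 p.2)) => //.
- exact: prod_covering cG cA.
- exact: hausdorff_pair.
- by apply: Ck_map_pair => //; [exact: Ck_map_cst|exact: Ck_map_id].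
Qed.

(** [expG] is assumed smooth along each line only, so linearity in [xi] becomes visible once the
    velocity is replaced by the tangent map at 1 of the orbit map. *)
Lemma inf_actionE xi m :
  inf_action A expG Ups xi m = tmap AG A (Ups ^~ m) 1%g xi.
Proof.
exact: (tmap_exp lieG expP xi cA hE (orbit_Ck 1 m 1%g)).
Qed.

Lemma inf_action_linear m : linear (fun xi => inf_action A expG Ups xi m).
Proof.
move=> a u v; rewrite !inf_actionE.
by apply: tmap_linear => //; exact: orbit_Ck.
Qed.

(* In the chart at [m], the curve [t |-> exp (t mu) m] is, near each time [s],
   the image under the translation by [exp (s mu)] of the same curve near time
   [0], where its velocity vanishes; hence it is constant. *)
Lemma stabilizer_fix mu m : stabilizer A expG Ups m mu ->
  \forall t \near (0 : R), Ups (expG (t *: mu)) m = m.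
Proof.
rewrite /stabilizer /= => mu0.
pose gam (t : R) := Ups (expG (t *: mu)) m.
pose c (t : R) := coord (A m) (gam t).
have gam0 : gam 0 = m by rewrite /gam (exp0 expP).
have gamD s t : gam (s + t) = Ups (expG (s *: mu)) (gam t).
  by case: (expP mu) => _ cD _; rewrite /gam -actionM -cD.
have gamC : continuous gam.
  move=> t; apply: (@continuous_comp _ _ _ (fun t : R => expG (t *: mu)) (Ups ^~ m)).
    exact: (exp_continuous expP).
  by case: (orbit_Ck 0 m (expG (t *: mu))).
have c0 : curve_derivative c 0.
  have [_ Cgam] : Ck_map 1 (@flat R R^o) A gam 0.
    apply: (Ck_map_comp (B := AG) _ _ _ _ _ (f := fun t : R^o => expG (t *: mu))
      (g := Ups ^~ m)) => //; [exact: cG|exact: exp_Ck|].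
    exact: orbit_Ck.
  have := @Ck_at_gderive_cvg _ R^o E _ _ 1 Cgam.
  rewrite -[gderive _ _ _]/(inf_action A expG Ups mu m) mu0.
  by rewrite /local_rep gam0.
have cs s : dom (A m) (gam s) ->
    (fun h : R => h^-1 *: (c (h + s) - c s)) @ (0 : R)^' --> (0 : E).
  move=> ds; pose x := expG (s *: mu).
  pose rep y := coord (A m) (Ups x (param (A m) y)).
  have Crep : Ck_at 1 rep (coord (A m) m).
    have Cact : Ck_at 1 (coord (A m) \o (fun p : G * M => Ups p.1 p.2)
        \o param (prod_atlas AG A (x, m))) (coord (prod_atlas AG A (x, m)) (x, m)).
      case: actP => _ _ sm; apply: smooth_Ck_at sm _ _; last exact: ds.
      exact: prod_covering cG cA _.
    have -> : rep = (coord (A m) \o (fun p : G * M => Ups p.1 p.2)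
        \o param (prod_atlas AG A (x, m))) \o
        (fun y => (coord (AG x) x, y)).
      by apply/funext => y /=; rewrite coordK //; exact: cG.
    apply: Ck_at_comp => //; first exact: hausdorff_pair.
    apply: Ck_at_pair => //; first exact: Ck_at_cst.
    by apply: Ck_at_linear => // y; exact: cvg_id.
  have rep0 : gderive rep (coord (A m) m) 0 = 0.
    by apply: gderive_eq => //; exact: quotient_at0.
  have crep : curve_derivative (rep \o c) 0.
    rewrite -[X in curve_derivative _ X]rep0.
    apply: (quotient_at_comp c0); rewrite /c gam0.
    exact: Ck_at_strong_derivative.
  have near_rep : \forall t \near (0 : R), (rep \o c) t = c (t + s).
    near=> t; rewrite /= /rep /c coordK; first by rewrite addrC gamD.
    near: t; apply: (gamC 0); rewrite gam0; exact: near_dom.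
  move/(curve_derivative_near near_rep)/curve_derivativeE: crep.
  by rewrite add0r.
(* Up to time [d] the orbit stays in the chart at [m], where coordinates determine the point. *)
have /nbhs_ballP[d /= d0 dd] : \forall t \near (0 : R), dom (A m) (gam t).
  by apply: (gamC 0); rewrite gam0; exact: near_dom.
apply/nbhs_ballP; exists d => //= t td.
have dt : dom (A m) (gam t) by exact: dd.
suff ct : c t = c 0.
  by rewrite -/(gam t) -(coordK dt) -/(c t) ct /c gam0 coordK.
have [->//|t0] := eqVneq t 0.
(* By separation it is enough to put [c t - c 0] into every neighbourhood of 0. The mean value
   principle for s |-> c (s t) on [0, 1], whose slopes tend to 0, puts it into every convex open
   one. *)
apply/eqP; rewrite -subr_eq0; apply/eqP/(nbhs0_eq0 hE) => U U0.
have [V [ [oV V0] VU cV]] := convex_nbhs U0; apply: VU.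
rewrite -[in c t](mul1r t) -[in c 0](mul0r t).
apply: (convex_mean_value (c := fun s => c (s * t))) => // s s0 s1.
have ds : dom (A m) (gam (s * t)).
  apply: dd; rewrite -ball_normE /= sub0r normrN normrM.
  move: td; rewrite -ball_normE /= sub0r normrN; apply: le_lt_trans.
  by rewrite ler_piMl // ger0_norm.
have : (fun h : R => t *: ((h * t)^-1 *: (c (h * t + s * t) - c (s * t))))
    @ (0 : R)^' --> (0 : E).
  rewrite -[X in _ --> X](scaler0 _ t); apply: cvgZt; first exact: cvg_cst.
  exact: cvg_comp (cvg_mulr_dnbhs t0) (cs _ ds).
move=> ct; near=> h.
have : V (t *: ((h * t)^-1 *: (c (h * t + s * t) - c (s * t)))).
  by near: h; exact: ct (open_nbhs_nbhs (conj oV V0)).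
by rewrite scalerA invfM mulrCA divff // mulr1 mulrDl.
Unshelve. all: by end_near.
Qed.

Section Isotropy.
Context (m : M) (mu : g) (mu0 : stabilizer A expG Ups m mu).

Let flow (t : R) : M -> M := Ups (expG (t *: mu)).
Let dflow (t : R) : E -> E := tmap A A (flow t) m.

(** The operator L of the overview: the isotropy representation of [mu] on the tangent space at
    [m]. *)
Definition isotropy (X : E) : E :=
  tmap (@flat R R^o) (@flat R E) (fun t : R^o => dflow t X) 0 1.

Let flow_Ck : Ck_map 2 (prod_atlas (@flat R R^o) A) A
  (fun p : R^o * M => flow p.1 p.2) (0 : R^o, m).
Proof.
apply: (Ck_map_comp (B := prod_atlas AG A) _ _ _ _ _
  (f := fun p : R^o * M => (expG (p.1 *: mu), p.2))
  (g := fun p : G * M => Ups p.1 p.2)) => //.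
- exact: prod_covering cG cA.
- by apply: hausdorff_pair => //; exact: Rhausdorff.
- exact: hausdorff_pair.
apply: Ck_map_pair => //; last exact: Ck_map_snd.
apply: (Ck_map_comp (B := @flat R R^o) _ _ _ _ _
  (f := fst) (g := fun t : R^o => expG (t *: mu))).
- exact: prod_covering (@flat_covering R R^o) cA.
- exact: flat_covering.
- by apply: hausdorff_pair => //; exact: Rhausdorff.
- exact: Rhausdorff.
- exact: hg.
- by apply: Ck_map_fst => //; exact: Rhausdorff.
- exact: exp_Ck.
Qed.

Let flow_fix : \forall t \near (0 : R^o), flow t m = m.
Proof. exact: stabilizer_fix. Qed.

Let dflow_continuous X :
  {for (0 : R, X), continuous (fun q : R * E => dflow q.1 q.2)}.
Proof.
exact: (family_continuous (@flat_covering R R^o) (@Rhausdorff R) hE hE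
  flow_fix flow_Ck).
Qed.

Let dflow_derivative X : curve_derivative (dflow ^~ X) (isotropy X).
Proof.
have [_] := family_Ck (@flat_covering R R^o) (@Rhausdorff R) hE hE
  flow_fix flow_Ck X.
exact: (@Ck_at_gderive_cvg _ R^o E (dflow ^~ X)).
Qed.

Let dflow_linear t : linear (dflow t).
Proof. by apply: tmap_linear => //; exact: translation_Ck. Qed.

Let dflow0 X : dflow 0 X = X.
Proof.
rewrite /dflow (_ : flow 0 = id) ?tmap_id //.
by apply/funext => n; rewrite /flow (exp0 expP) action1.
Qed.

Lemma isotropyD X Y : isotropy (X + Y) = isotropy X + isotropy Y.
Proof.
apply: (curve_derivative_unique hE); first exact: dflow_derivative.
have /curve_derivativeE dX := @dflow_derivative X.
have /curve_derivativeE dY := @dflow_derivative Y.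
apply/curve_derivativeE; apply: (cvg_near_eq _ (cvgDt dX dY)); near=> h.
by rewrite -scalerDr !(linear_mapD (dflow_linear _)) opprD addrACA.
Unshelve. all: by end_near.
Qed.

(** If [x] fixes [m], so does its inverse, and (x y x^-1) m = x (y m). The tangent maps at y = 1
    give (Ad x xi) . m = D (xi . m), with D the differential of [Ups x] at [m]; for x = exp (t mu)
    both sides are then differentiated at t = 0. *)
Lemma isotropy_inf_action xi :
  inf_action A expG Ups (bracket AG mu xi) m = isotropy (inf_action A expG Ups xi m).
Proof.
apply: (curve_derivative_unique hE); last exact: dflow_derivative.
apply: (@curve_derivative_near _ _
    (fun t => inf_action A expG Ups (Ad AG (expG (t *: mu)) xi) m)); last first.
  apply: (curve_derivative_linear (L := fun xi => inf_action A expG Ups xi m)).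
  - exact: inf_action_linear.
  - have -> : (fun xi => inf_action A expG Ups xi m) = tmap AG A (Ups ^~ m) 1%g.
      by apply/funext => eta; exact: inf_actionE.
    by apply: tmap_continuous; exact: orbit_Ck.
  - exact: curve_derivative_Ad.
near=> t; have fixt : flow t m = m by near: t; exact: flow_fix.
set x := expG (t *: mu); rewrite /dflow /flow -/x !inf_actionE.
have fixV : Ups x^-1%g m = m by rewrite -[in LHS]fixt -actionM mulVg action1.
transitivity (tmap AG A (Ups ^~ m \o (fun y => (x * y * x^-1)%g)) 1%g xi).
  rewrite (tmap_comp (B := AG)) //; first by rewrite mulg1 mulgV.
  - exact: cG.
  - exact: cG.
  - exact: conj_Ck.
  - exact: orbit_Ck.
have -> : Ups ^~ m \o (fun y => (x * y * x^-1)%g) = Ups x \o Ups ^~ m.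
  by apply/funext => y /=; rewrite !actionM fixV.
rewrite (tmap_comp (B := A)) //; first by rewrite action1.
- exact: cG.
- exact: orbit_Ck.
- exact: translation_Ck.
Unshelve. all: by end_near.
Qed.

(* [gderive] returns [0] where there is no derivative, so [tau' = 0] is exploited
   by showing that the derivative exists, with value the commutator of [isotropy]
   and [j m]. *)
Lemma isotropy_almost_complex (j : M -> E -> E) X : linear (j m) ->
  continuous (j m) -> tau' A expG Ups j mu m X = 0 ->
  isotropy (j m X) = j m (isotropy X).
Proof.
move=> lj cj jinv.
(* While the flow fixes [m], [tau] at exp (t mu) is D_t (j_m (D_(-t) X)) - j_m X; [c] is the part
   inside D_t. *)
pose c t := j m (dflow (- t) X).
have c0 : c 0 = j m X by rewrite /c oppr0 dflow0.
have dc : curve_derivative c (j m (- isotropy X)).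
  apply: (curve_derivative_linear (L := j m) (c := fun t => dflow (- t) X)) => //.
  exact: (curve_derivative_opp (dflow_derivative (X := X))).
have dtau : curve_derivative (fun t => dflow t (c t) - j m X)
    (isotropy (j m X) - j m (isotropy X)).
  have dD : curve_derivative (fun t => dflow t (c t))
      (isotropy (j m X) - j m (isotropy X)).
    have -> : - j m (isotropy X) = dflow 0 (j m (- isotropy X)).
      by rewrite dflow0 (linear_mapN lj).
    (* The product rule differentiates the outer D_t at [c 0], that is at j_m X, and then the inner
       curve, whose derivative is - j_m (L X). *)
    apply: curve_derivative_leibniz dc => //; last by rewrite c0.
    by near=> t.
  move/curve_derivativeE: dD => dD; apply/curve_derivativeE.
  apply: (cvg_near_eq _ dD); near=> h.
  by rewrite opprB addrA subrK.
apply/eqP; rewrite -subr_eq0; apply/eqP; rewrite -jinv.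
apply/esym/(gderive_eq hE); apply: (curve_derivative_near _ dtau); near=> t.
have fixt : flow t m = m by near: t; exact: flow_fix.
have fixV : Ups (expG (t *: mu))^-1%g m = m.
  by rewrite -[in LHS]fixt -actionM mulVg action1.
by rewrite /tau fixV /c /dflow /flow (expN expP).
Unshelve. all: by end_near.
Qed.

End Isotropy.

End Action.

(** At [m], read in the chart selected at [m], the two tangent maps in the smoothness condition are
    identities, so [j m] is a slice of a smooth map. *)
Lemma almost_complex_continuous {R : realType} {M : topologicalType}
    {E : tvsType R} (A : atlas M E) (j : M -> E -> E) m :
  covering_atlas A -> hausdorff_space E -> almost_complex A j ->
  continuous (j m).
Proof.
move=> cA hE [lj sj _] X.
pose F (p : E * E) := let q := param (A m) p.1 in
  tmap A (@flat R E) (coord (A m)) q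
    (j q (tmap (@flat R E) A (param (A m)) p.1 p.2)).
have idE (Y : E) (f : E -> E) : (\forall x \near coord (A m) m, x = f x) ->
    gderive f (coord (A m) m) Y = Y.
  move=> fE; rewrite -(gderive_near _ fE); apply: gderive_eq => //.
  exact: quotient_at_linear.
have FE : j m = fun Y => F (coord (A m) m, Y).
  apply/funext => Y; rewrite /F /= coordK //.
  rewrite /tmap /= coordK // idE; last first.
    by near=> x; rewrite /= paramK //; near: x; exact: near_cod.
  rewrite idE //.
  by near=> x; rewrite /= paramK //; near: x; exact: near_cod.
rewrite FE; apply: (@continuous_comp _ _ _ (fun Y => (coord (A m) m, Y)) F X).
  by apply: continuous_pair; [exact: cvg_cst|exact: cvg_id].
apply: (Ck_on_continuous (sj m 0)); split=> //=.
by exists m.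
Unshelve. all: by end_near.
Qed.

(** * Commuting Hermitian operators *)

Section Subspaces.
Context {K : nzRingType} {V : lmodType K}.

Lemma subspace0 (W : set V) : is_subspace W -> W 0.
Proof. by case; rewrite inE. Qed.

Lemma subspaceP (W : set V) a u v : is_subspace W -> W u -> W v -> W (a *: u + v).
Proof. by move=> [_ /(_ a u v)]; rewrite !inE. Qed.

Lemma subspaceZ (W : set V) a u : is_subspace W -> W u -> W (a *: u).
Proof.
by move=> sW Wu; rewrite -[_ *: _]addr0; apply: subspaceP => //; exact: subspace0.
Qed.

Lemma subspace_sum (W : set V) n (F : 'I_n -> V) :
  is_subspace W -> (forall i, W (F i)) -> W (\sum_i F i).
Proof.
move=> sW WF; elim/big_ind : _ => [|u v Wu Wv|i _]; [exact: subspace0| |exact: WF].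
by rewrite -[u]scale1r; exact: subspaceP.
Qed.

End Subspaces.

Section Independence.
Context {K : fieldType} {V : lmodType K}.

Definition independent n (b : 'I_n -> V) : Prop :=
  forall c : 'I_n -> K, \sum_i c i *: b i = 0 -> forall i, c i = 0.

(** Dimension is bounded through lengths of independent families, a notion inherited by arbitrary
    subsets; [finite_dimensional] asks only that the set lie in a finite span. *)
Definition dim_le n (S : set V) : Prop :=
  forall k (b : 'I_k -> V), (forall i, S (b i)) -> independent b -> (k <= n)%N.

Lemma dim_le_sub n (S W : set V) : W `<=` S -> dim_le n S -> dim_le n W.
Proof. by move=> WS dS k b Wb; apply: dS => i; exact: WS. Qed.

(** More than [n] vectors in the span of [n] have a coefficient matrix with nonzero left kernel, and
    a row of that kernel is a linear relation. *)
Lemma finite_dimensional_dim_le (S : set V) :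
  finite_dimensional S -> exists n, dim_le n S.
Proof.
move=> [n [e eS]]; exists n => k b Sb ib.
have /choice[M bE] : forall i, exists c : 'I_n -> K, b i = \sum_j c j *: e j.
  by move=> i; exact: eS.
rewrite leqNgt; apply/negP => nk.
pose B : 'M[K]_(k, n) := \matrix_(i, j) M i j.
have : kermx B != 0.
  by rewrite -mxrank_eq0 mxrank_ker subn_eq0 -ltnNge (leq_ltn_trans (rank_leq_col _)).
move=> /matrix0Pn[r [s rs]].
pose u := row r (kermx B).
have uB : u *m B = 0.
  by apply/sub_kermxP; exact: row_sub.
have : \sum_i u 0 i *: b i = 0.
  transitivity (\sum_j (u *m B) 0 j *: e j); last first.
    by rewrite uB big1 // => j _; rewrite mxE scale0r.
  under eq_bigr => i _ do rewrite bE scaler_sumr.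
  rewrite exchange_big; apply: eq_bigr => j _.
  rewrite mxE scaler_suml; apply: eq_bigr => i _.
  by rewrite scalerA [B i j]mxE.
by move=> /ib /(_ s); rewrite mxE => /eqP; rewrite (negbTE rs).
Qed.

(** An independent family in [W] stays independent after adjoining [x], which lies outside [W]. The
    empty family gives [0 < n]. *)
Lemma dim_le_proper n (S W : set V) x : is_subspace W -> W `<=` S -> S x ->
  ~ W x -> dim_le n S -> (0 < n)%N /\ dim_le n.-1 W.
Proof.
move=> sW WS Sx Wx dS.
have ext k (b : 'I_k -> V) : (forall i, W (b i)) -> independent b -> (k.+1 <= n)%N.
  move=> Wb ib.
  apply: (dS _ (fun i => if unlift ord0 i is Some j then b j else x)).
    by move=> i; case: unliftP => [j|] _ //; exact: WS.
  move=> c; rewrite big_ord_recl unlift_none => cE.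
  have {}cE : c ord0 *: x + \sum_(i < k) c (lift ord0 i) *: b i = 0.
    rewrite -[RHS]cE; congr (_ + _); apply: eq_bigr => i _.
    by rewrite liftK.
  have Wsum : W (\sum_(i < k) c (lift ord0 i) *: b i).
    by apply: subspace_sum => // i; exact: subspaceZ.
  have c0 : c ord0 = 0.
    apply/eqP/negPn/negP => c0; apply: Wx.
    have -> : x = - (c ord0)^-1 *: (\sum_(i < k) c (lift ord0 i) *: b i).
      move/eqP: cE; rewrite addrC addr_eq0 => /eqP ->.
      by rewrite scaleNr scalerN opprK scalerA mulVf // scale1r.
    exact: subspaceZ.
  move: cE; rewrite c0 scale0r add0r => /ib ci i.
  by case: (unliftP ord0 i) => [j ->|->].
have n0 : (0 < n)%N.
  by apply: (ext 0%N (fun=> 0)) => [[]//|c _ []].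
by split=> // k b Wb ib; rewrite -ltnS prednK //; exact: ext.
Qed.

End Independence.

Section Eigenvectors.
Context {C : closedFieldType} {V : lmodType C}.

(* If [p] is a nonzero polynomial of least degree with [p(T) v = 0] and [a] is a
   root of [p], then [(p / (X - a))(T) v] is an eigenvector. *)
Lemma exists_eigenvector n (W : set V) (T : V -> V) v : linear T ->
  is_subspace W -> dim_le n W -> (forall w, W w -> W (T w)) -> W v -> v != 0 ->
  exists a w, [/\ W w, w != 0 & T w = a *: w].
Proof.
move=> lT sW dW TW Wv v0.
pose ev (p : {poly C}) := \sum_(i < size p) p`_i *: iter i T v.
have evE N (p : {poly C}) : (size p <= N)%N -> ev p = \sum_(i < N) p`_i *: iter i T v.
  move=> pN; rewrite /ev (big_ord_widen _ (fun i => p`_i *: iter i T v) pN).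
  rewrite big_mkcond; apply: eq_bigr => i _; case: ifPn => //.
  by rewrite -leqNgt => /leq_sizeP -> //; rewrite scale0r.
have Wi i : W (iter i T v) by elim: i => //= i; exact: TW.
have Tsum m (F : 'I_m -> V) : T (\sum_i F i) = \sum_i T (F i).
  elim/big_rec2 : _ => [|i y1 y2 _ <-]; first exact: linear_map0 lT.
  exact: (linear_mapD lT).
(* The [n + 1] vectors v, T v, ..., T^n v lie in [W], so they are dependent. *)
have ann : exists k, `[< exists p : {poly C}, [/\ p != 0, ev p = 0 & size p = k] >].
  have : ~ independent (fun i : 'I_n.+1 => iter i T v).
    by move=> /(dW _ _ (fun i : 'I_n.+1 => Wi i)); rewrite ltnn.
  move=> /existsNP[c /not_implyP[c0 /existsNP[i ci]]].
  pose p := \poly_(i < n.+1) (if insub i is Some j then c j else 0).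
  have pE (j : 'I_n.+1) : p`_j = c j by rewrite coef_poly ltn_ord valK.
  exists (size p); apply/asboolP; exists p; split=> //.
    by apply/eqP => p0; apply: ci; rewrite -pE p0 coef0.
  rewrite (evE n.+1) ?size_poly // -[RHS]c0.
  by apply: eq_bigr => j _; rewrite pE.
case: (ex_minnP ann) => k /asboolP[p [p0 evp sp]] kmin.
(* A nonzero constant c would give c v = 0 with v nonzero; hence [p] has a root. *)
have sp1 : size p != 1.
  apply/eqP => /eqP/size_poly1P[c c0 pc]; move: evp; rewrite pc (evE 1) ?size_polyC ?c0 //.
  rewrite big_ord1 coefC /= => /eqP; rewrite scaler_eq0 (negbTE c0).
  by rewrite (negbTE v0).
have /closed_rootP[a /factor_theorem[q pq]] := sp1.
have q0 : q != 0 by apply: contra p0 => /eqP q0; rewrite pq q0 mul0r.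
have spq : size p = (size q).+1 by rewrite pq size_Mmonic ?monicXsubC // size_XsubC addn2.
exists a, (ev q); split.
- by apply: subspace_sum => // i; exact: subspaceZ.
- apply/eqP => evq; have : (k <= size q)%N by apply: kmin; apply/asboolP; exists q.
  by rewrite -sp spq ltnn.
apply/eqP; rewrite -subr_eq0; apply/eqP; rewrite -[RHS]evp.
(* From p = q (X - a): p_0 = - q_0 a and p_(i+1) = q_i - q_(i+1) a, so p(T) v regroups as T (q(T) v)
   - a q(T) v. *)
rewrite (evE (size q).+1 p) ?spq // big_ord_recl /= pq.
under eq_bigr => i _.
  rewrite /bump /= add1n mulrBr coefB coefMX coefMC /= scalerBl.
over.
rewrite sumrB mulrBr coefB coefMX coefMC /= sub0r addrCA.
congr (_ + _).
  by rewrite /ev Tsum; apply: eq_bigr => i _; rewrite (linear_mapZ lT).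
rewrite scaleNr -opprD; congr (- _).
have -> : q`_0 * a *: v = q`_(@ord0 (size q)) * a *: iter (@ord0 (size q)) T v by [].
rewrite (evE (size q).+1 q) // scaler_sumr big_ord_recl /=; congr (_ + _).
  by rewrite scalerA mulrC.
by apply: eq_bigr => i _; rewrite scalerA mulrC.
Qed.

(** If every [T i] is scalar on [W], any nonzero vector serves. Otherwise some [T i] has an
    eigenspace in [W] that is nonzero and proper, and invariant under the whole family by
    commutation; the dimension bound drops there, whatever the size of [I]. *)
Lemma exists_common_eigenvector n (I : Type) (W : set V) (T : I -> V -> V) v :
  (forall i, linear (T i)) -> (forall i k w, T i (T k w) = T k (T i w)) ->
  is_subspace W -> dim_le n W -> (forall i w, W w -> W (T i w)) ->
  W v -> v != 0 ->
  exists (a : I -> C) w, [/\ W w, w != 0 & forall i, T i w = a i *: w].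
Proof.
move=> lT cT; elim/ltn_ind: n W v => n IH W v sW dW TW Wv v0.
have [scal|/existsNP[i nscal]] :=
    pselect (forall i, exists a, forall w, W w -> T i w = a *: w).
  by have [a aT] := choice scal; exists a, v; split=> // i; exact: aT.
have [a [w [Ww w0 Tw]]] := exists_eigenvector (lT i) sW dW (TW i) Wv v0.
have /existsNP[x /not_implyP[Wx Tx]] : ~ forall w, W w -> T i w = a *: w.
  by move=> Ta; apply: nscal; exists a.
pose W' := [set u | W u /\ T i u = a *: u].
have sW' : is_subspace W'.
  split=> [|b u u']; rewrite !inE.
    by split; [exact: subspace0|rewrite (linear_map0 (lT i)) scaler0].
  move=> [Wu Tu] [Wu' Tu']; split; first exact: subspaceP.
  by rewrite lT Tu Tu' scalerDr !scalerA mulrC.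
have W'W : W' `<=` W by move=> u [].
have [n0 dW'] := dim_le_proper sW' W'W Wx (fun W'x => Tx W'x.2) dW.
have [| |||b [u [ [Wu _] u0 Tu]]] // := IH n.-1 _ W' w sW' dW'.
- by rewrite prednK.
- by move=> k u [Wu Tu]; split; [exact: TW|rewrite cT Tu (linear_mapZ (lT k))].
by exists b, u.
Qed.

End Eigenvectors.

Section HermitianForms.
Context {C : numClosedFieldType} {V : lmodType C}.

Definition hermitian_inner (h : V -> V -> C) : Prop :=
  [/\ forall w, scalar (h ^~ w), forall v w, h w v = (h v w)^* &
      forall v, h v v = 0 -> v = 0].

Context (h : V -> V -> C) (hP : hermitian_inner h).

Lemma hermD u v w : h (u + v) w = h u w + h v w.
Proof. by case: hP => hl _ _; have := hl w 1 u v; rewrite scale1r /= mul1r. Qed.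

Lemma herm0 w : h 0 w = 0.
Proof. by apply: (addrI (h 0 w)); rewrite -hermD !addr0. Qed.

Lemma hermZ a v w : h (a *: v) w = a * h v w.
Proof. by case: hP => hl _ _; have := hl w a v 0; rewrite addr0 /= herm0 addr0. Qed.

Lemma hermC v w : h w v = (h v w)^*.
Proof. by case: hP. Qed.

Lemma hermZr a v w : h v (a *: w) = a^* * h v w.
Proof. by rewrite hermC hermZ rmorphM /= -hermC. Qed.

Lemma herm_sum n (F : 'I_n -> V) w : h (\sum_i F i) w = \sum_i h (F i) w.
Proof.
elim/big_rec2 : _ => [|i y1 y2 _ <-]; first exact: herm0.
exact: hermD.
Qed.

Lemma herm_neq0 v : v != 0 -> h v v != 0.
Proof. by case: hP => _ _ h0; apply: contra => /eqP /h0 ->. Qed.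

Lemma orthogonal_independent n (b : 'I_n -> V) : (forall i, b i != 0) ->
  (forall i k, i != k -> h (b i) (b k) = 0) -> independent b.
Proof.
move=> b0 bo c cb k.
have : h (\sum_i c i *: b i) (b k) = 0 by rewrite cb herm0.
rewrite herm_sum (bigD1 k) //= big1 => [|i ik]; last by rewrite hermZ bo // mulr0.
rewrite addr0 hermZ => /eqP; rewrite mulf_eq0 (negbTE (herm_neq0 (b0 k))) orbF.
by move=> /eqP.
Qed.

(* An orthogonal family of common eigenvectors in [S] of maximal length spans
   [S]: its orthogonal complement in [S] is invariant, so it would contain
   another common eigenvector. *)
Lemma orthogonal_common_eigenbasis n (I : Type) (S : set V) (T : I -> V -> V) :
  (forall i, linear (T i)) -> (forall i k w, T i (T k w) = T k (T i w)) ->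
  (forall i v w, h (T i v) w = h v (T i w)) ->
  is_subspace S -> dim_le n S -> (forall i w, S w -> S (T i w)) ->
  exists r (b : 'I_r -> V) (a : 'I_r -> I -> C),
    [/\ forall k, S (b k) /\ b k != 0, forall k i, T i (b k) = a k i *: b k &
        forall v, S v -> v = \sum_k (h v (b k) / h (b k) (b k)) *: b k].
Proof.
move=> lT cT hT sS dS TS.
pose eigenfamily r := exists (b : 'I_r -> V) (a : 'I_r -> I -> C),
  [/\ forall k, S (b k) /\ b k != 0, forall k i, T i (b k) = a k i *: b k &
      forall k l : 'I_r, k != l -> h (b k) (b l) = 0].
have ex0 : exists r, `[< eigenfamily r >].
  by exists 0%N; apply/asboolP; exists (fun=> 0), (fun _ _ => 0); split=> [] [].
have bound r : `[< eigenfamily r >] -> (r <= n)%N.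
  move=> /asboolP[b [a [Sb _ bo]]]; apply: (dS r b) => [k|]; first by case: (Sb k).
  by apply: orthogonal_independent => // k; case: (Sb k).
case: (ex_maxnP ex0 bound) => r /asboolP[b [a [Sb Tb bo]]] rmax.
exists r, b, a; split=> // v Sv.
pose W := [set w | S w /\ forall k, h w (b k) = 0].
have sW : is_subspace W.
  split=> [|c u u']; rewrite !inE.
    by split=> [|k]; [exact: subspace0|exact: herm0].
  move=> [Su hu] [Su' hu']; split=> [|k]; first exact: subspaceP.
  by rewrite hermD hermZ hu hu' mulr0 addr0.
have WS : W `<=` S by move=> w [].
have TW i w : W w -> W (T i w).
  move=> [Sw hw]; split=> [|k]; first exact: TS.
  by rewrite hT Tb hermZr hw mulr0.
apply/eqP; rewrite -subr_eq0; apply/negPn/negP => w0.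
(* The residue of [v] after orthogonal projection to the family: if nonzero, it provides a vector
   from which the family can be extended. *)
set w := _ - _ in w0.
have Ww : W w.
  split.
    rewrite /w addrC -scaleN1r; apply: subspaceP => //; apply: subspace_sum => // k.
    by apply: subspaceZ => //; case: (Sb k).
  move=> l; rewrite /w hermD -scaleN1r hermZ mulN1r herm_sum (bigD1 l) //=.
  rewrite big1 => [|k kl]; last by rewrite hermZ (bo k l) // mulr0.
  by rewrite addr0 hermZ divfK ?subrr // herm_neq0 //; case: (Sb l).
have [c [u [Wu u0 Tu]]] :=
  exists_common_eigenvector lT cT sW (dim_le_sub WS dS) TW Ww w0.
have : (r.+1 <= r)%N; last by rewrite ltnn.
apply: rmax; apply/asboolP.
exists (fun i => if unlift ord0 i is Some k then b k else u),
  (fun i => if unlift ord0 i is Some k then a k else c).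
have ub k : h u (b k) = 0 by case: Wu.
split=> [k|k i|k l].
- by case: unliftP => [k' _|_]; [exact: Sb|split=> //; exact: WS].
- by case: unliftP => [k' _|_]; [exact: Tb|exact: Tu].
- case: unliftP => [k' ->|->]; case: unliftP => [l' ->|->] //.
  + by rewrite (inj_eq lift_inj); exact: bo.
  + by rewrite hermC ub rmorph0.
Qed.

End HermitianForms.

(** * Weight spaces *)

Section ComplexifiedAlgebra.
Context {R : realType} {g : lmodType R} (br : g -> g -> g) (kappa : g -> g -> R).
Hypotheses (brl : forall eta, linear (br ^~ eta)) (brr : forall xi, linear (br xi)).
Hypothesis brJ : forall mu xi eta,
  br mu (br xi eta) = br (br mu xi) eta + br xi (br mu eta).
Hypothesis kappaP : inner_pairing kappa.

Local Notation gC := (complexification g).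
Local Notation ad mu := (bilinear_ext br (real_part_embed mu)).
Local Notation brC := (bilinear_ext br).
Local Notation hC := (hermitian_ext kappa).

Let br0l y : br 0 y = 0.
Proof. exact: linear_map0 (brl y). Qed.
Let brZl a x y : br (a *: x) y = a *: br x y.
Proof. exact: linear_mapZ (brl y) _ _. Qed.
Let brNl x y : br (- x) y = - br x y.
Proof. exact: linear_mapN (brl y) _. Qed.
Let brZr a x y : br x (a *: y) = a *: br x y.
Proof. exact: linear_mapZ. Qed.
Let brDr x y y' : br x (y + y') = br x y + br x y'.
Proof. exact: linear_mapD. Qed.
Let brNr x y : br x (- y) = - br x y.
Proof. exact: linear_mapN. Qed.

Lemma scale_realE (x : R) (z : gC) : x%:C%C *: z = (x *: z.1, x *: z.2).
Proof. by congr pair; rewrite /= scale0r ?subr0 ?addr0. Qed.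

Lemma scale_iE (z : gC) : 'i%C *: z = (- z.2, z.1).
Proof. by congr pair; rewrite /= scale0r scale1r add0r. Qed.

Lemma adE mu (z : gC) : ad mu z = (br mu z.1, br mu z.2).
Proof. by rewrite /bilinear_ext /= !br0l subr0 addr0. Qed.

Lemma ad_linear mu : linear (fun z : gC => ad mu z).
Proof.
move=> a z w; rewrite !adE; congr pair => /=.
  by rewrite brDr brDr brNr !brZr.
by rewrite brDr brDr !brZr.
Qed.

Lemma adZ mu a (z : gC) : ad mu (a *: z) = a *: ad mu z.
Proof. exact: linear_mapZ (ad_linear mu) _ _. Qed.

Lemma ad_comm mu nu (z : gC) : br mu nu = 0 -> ad mu (ad nu z) = ad nu (ad mu z).
Proof. by move=> mn; rewrite !adE /= !(brJ mu nu) mn !br0l !add0r. Qed.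

Lemma ad_brC mu (z w : gC) : ad mu (brC z w) = brC (ad mu z) w + brC z (ad mu w).
Proof.
rewrite !adE; congr pair => /=; by rewrite brDr ?brNr !(brJ mu) ?opprD addrACA.
Qed.

(** With the three lemmas below, this covers the scalars occurring in a weight equation: i and the
    real values of a weight. *)
Lemma brC_scale_i_l (z w : gC) : brC ('i%C *: z) w = 'i%C *: brC z w.
Proof.
rewrite !scale_iE; congr pair => /=; rewrite brNl.
  by rewrite opprD addrC.
by rewrite addrC.
Qed.

Lemma brC_scale_i_r (z w : gC) : brC z ('i%C *: w) = 'i%C *: brC z w.
Proof. by rewrite !scale_iE; congr pair => /=; rewrite brNr // opprD. Qed.

Lemma brC_scale_real_l (x : R) (z w : gC) :
  brC (x%:C%C *: z) w = x%:C%C *: brC z w.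
Proof. by rewrite !scale_realE; congr pair => /=; rewrite !brZl ?scalerBr ?scalerDr. Qed.

Lemma brC_scale_real_r (x : R) (z w : gC) :
  brC z (x%:C%C *: w) = x%:C%C *: brC z w.
Proof. by rewrite !scale_realE; congr pair => /=; rewrite !brZr ?scalerBr ?scalerDr. Qed.

Let kappal eta a u v : kappa (a *: u + v) eta = a * kappa u eta + kappa v eta.
Proof. by case: kappaP => kl _ _ _; exact: kl. Qed.
Let kappaC u v : kappa u v = kappa v u.
Proof. by case: kappaP. Qed.
Let kappa0l v : kappa 0 v = 0.
Proof. by have := kappal v (-1) 0 0; rewrite scaler0 addr0 mulN1r addNr. Qed.
Let kappaZl a u v : kappa (a *: u) v = a * kappa u v.
Proof. by rewrite -[a *: u]addr0 kappal kappa0l addr0. Qed.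
Let kappaDl u u' v : kappa (u + u') v = kappa u v + kappa u' v.
Proof. by have := kappal v 1 u u'; rewrite scale1r mul1r. Qed.
Let kappaNl u v : kappa (- u) v = - kappa u v.
Proof. by rewrite -scaleN1r kappaZl mulN1r. Qed.

Lemma hermitian_ext_inner : hermitian_inner hC.
Proof.
split=> [w a z z'|z w|z].
- rewrite /hermitian_ext /= !kappaDl !kappaNl !kappaZl.
  case: a => a b /=; apply/eqP; rewrite eq_complex /=.
  by apply/andP; split; apply/eqP; ring.
- rewrite /hermitian_ext (kappaC w.1) (kappaC w.2) (kappaC w.2) (kappaC w.1 z.2).
  by apply/eqP; rewrite eq_complex /= eqxx opprB eqxx.
- case: z => x y [/= xy _].
  case: kappaP => _ _ _ kpos.
  have k0 u : 0 <= kappa u u.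
    by have [->|u0] := eqVneq u 0; [rewrite kappa0l|exact: ltW (kpos _ u0)].
  have kx u : kappa u u = 0 -> u = 0.
    by move=> ku; apply/eqP/negPn/negP => /kpos; rewrite ku ltxx.
  by have /eqP := xy; rewrite paddr_eq0 // => /andP[/eqP /kx -> /eqP /kx ->].
Qed.

Context (t : set g).
Hypothesis t_inv : invariant_pairing br kappa t.

(** Two signs cancel: [ad mu] is skew for [kappa], and i becomes -i when taken out of the antilinear
    second argument. *)
Lemma hermitian_ad mu (z w : gC) : t mu ->
  hC ('i%C *: ad mu z) w = hC z ('i%C *: ad mu w).
Proof.
move=> tmu; have sk x y : kappa (br mu x) y = - kappa x (br mu y).
  by apply/eqP; rewrite -addr_eq0 t_inv.
have kappaNr u v : kappa u (- v) = - kappa u v by rewrite kappaC kappaNl kappaC.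
rewrite !scale_iE !adE /hermitian_ext /= !kappaNl !kappaNr !sk !opprK.
apply/eqP; rewrite eq_complex /=.
by apply/andP; split; apply/eqP; ring.
Qed.

End ComplexifiedAlgebra.

Lemma finite_support_seq (I : choiceType) (V : nmodType) (z : I -> V) :
  finite_set [set i | z i != 0] ->
  exists s, uniq s /\ forall i, i \notin s -> z i = 0.
Proof.
move=> /finite_seqP[s zs]; exists (undup s); split; first exact: undup_uniq.
move=> i; rewrite mem_undup; apply: contraNeq => zi.
by have : [set i | z i != 0] i by []; rewrite zs.
Qed.

Lemma fsum_seq (I : choiceType) (V : nmodType) (A : set I) (z : I -> V) (s : seq I) :
  uniq s -> (forall i, i \notin s -> z i = 0) -> (forall i, ~ A i -> z i = 0) ->
  \sum_(i \in A) z i = \sum_(i <- s) z i.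
Proof.
move=> us zs zA; rewrite (fsbigE [seq i <- s | i \in A]).
- rewrite big_filter_cond [RHS](bigID (mem A)) /= [X in _ = _ + X]big1 ?addr0.
    by apply: eq_bigl => i; rewrite andbb.
  by move=> i; rewrite notin_setE => /zA.
- exact: filter_uniq.
- by move=> i /=; rewrite mem_filter => /andP[/set_mem].
- move=> i Ai; rewrite mem_filter mem_set //=; exact: zs.
Qed.

Section WeightDecomposition.
Context {R : realType} {g : lmodType R} (br : g -> g -> g) (kappa : g -> g -> R).
Hypotheses (brl : forall eta, linear (br ^~ eta)) (brr : forall xi, linear (br xi)).
Hypothesis brJ : forall mu xi eta,
  br mu (br xi eta) = br (br mu xi) eta + br xi (br mu eta).
Hypothesis kappaP : inner_pairing kappa.
Context (t : set g) (t_ab : abelian_subalgebra br t)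
  (t_inv : invariant_pairing br kappa t).

Local Notation gC := (complexification g).
Local Notation ad mu := (bilinear_ext br (real_part_embed mu)).
Local Notation brC := (bilinear_ext br).
Local Notation hC := (hermitian_ext kappa).

Context (S : set gC) (sS : is_subspace S)
  (adS : forall mu z, t mu -> S z -> S (ad mu z)).

Local Notation k := (weight_space br S : (t -> R) -> set gC).

Lemma weight_space_subspace lambda : is_subspace (k lambda).
Proof.
split=> [|a z w]; rewrite !inE.
  split=> [|mu]; first exact: subspace0.
  by rewrite (linear_map0 (ad_linear brl brr _)) !scaler0.
move=> [Sz kz] [Sw kw]; split=> [|mu]; first exact: subspaceP.
rewrite ad_linear // !scalerDr -kw scalerA [_ * a]mulrC -scalerA kz.
by rewrite scalerA mulrC -scalerA.
Qed.

Lemma commuting_part_weight0 : commuting_part br t S = k 0.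
Proof.
apply/seteqP; split=> z [Sz kz]; split=> // mu.
  by rewrite kz ?scaler0 ?scale0r //; exact: set_valP.
move=> tmu; have := kz (exist _ mu (mem_set tmu)); rewrite /= scale0r => /eqP.
have i0 : ('i%C : R[i]) != 0 by rewrite eq_complex /= oner_eq0 andbF.
by rewrite scaler_eq0 (negbTE i0) => /eqP.
Qed.

(** Moving i ad mu across the form multiplies it by lambda(mu) on one side and by the real number
    nu(mu) on the other; some [mu] separates the two weights. *)
Lemma weight_spaces_orthogonal (lambda nu : t -> R) z w :
  lambda <> nu -> k lambda z -> k nu w -> hC z w = 0.
Proof.
move=> ln [_ kz] [_ kw].
have [mu lnmu] : exists mu, lambda mu <> nu mu.
  by apply/existsNP => e; apply: ln; apply/funext.
have hP := hermitian_ext_inner kappaP.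
have := hermitian_ad brl kappaP t_inv z w (set_valP mu).
rewrite kz kw hermZ // hermZr // => /eqP.
have -> : ((nu mu)%:C%C : R[i])^* = (nu mu)%:C%C by exact: conjc_real.
rewrite -subr_eq0 -mulrBl mulf_eq0 subr_eq0 => /orP[|/eqP //].
by move=> /eqP /complexI /lnmu.
Qed.

Lemma weight_space_bracket (lambda nu : t -> R) :
  linear_span [set brC z w | z in k lambda & w in k nu] `&` S
    `<=` k (lambda + nu).
Proof.
move=> z [zspan Sz]; split=> //.
(* The stabilizer need not be closed under brackets, so the weight equation is propagated through
   the span inside all of g_C; membership in [S] is supplied by the intersection. *)
pose W := [set v : gC | forall mu : t,
  'i%C *: ad (\val mu) v = ((lambda + nu) mu)%:C%C *: v].
suff : W z by [].
apply: zspan; split.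
  split=> [|a u v]; rewrite !inE.
    move=> mu.
    by rewrite (linear_map0 (ad_linear brl brr _)) !scaler0.
  move=> Wu Wv mu.
  rewrite ad_linear // !scalerDr -Wv scalerA [_ * a]mulrC -scalerA Wu.
  by rewrite scalerA mulrC -scalerA.
move=> _ [u [_ ku] [v [_ kv] <-]] mu.
rewrite ad_brC // scalerDr -brC_scale_i_l // ku -brC_scale_i_r // kv.
by rewrite brC_scale_real_l // brC_scale_real_r // -scalerDl -rmorphD.
Qed.

Lemma weights_real (b : gC) (a : t -> R[i]) : b != 0 ->
  (forall mu : t, 'i%C *: ad (\val mu) b = a mu *: b) ->
  forall mu, a mu = (complex.Re (a mu))%:C%C.
Proof.
move=> b0 ba mu; have hP := hermitian_ext_inner kappaP.
have := hermitian_ad brl kappaP t_inv b b (set_valP mu).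
rewrite ba hermZ // hermZr // => /eqP.
rewrite -subr_eq0 -mulrBl mulf_eq0 subr_eq0 (negbTE (herm_neq0 hP b0)) orbF.
case: (a mu) => x y; rewrite eq_complex /= eqxx /= -addr_eq0 -mulr2n.
by rewrite mulrn_eq0 /= => /eqP ->.
Qed.

(** Eigenvalues arise for each [mu] separately. Linearity in [mu] follows by evaluating the linear
    map mu |-> i ad mu on the one nonzero vector [b]. *)
Lemma weight_dual (lambda : t -> R) b : b != 0 -> k lambda b ->
  dual_space lambda.
Proof.
move=> b0 [_ kb] a mu nu rho e.
have adr x : 'i%C *: ad x b = 'i%C *: ((br x b.1, br x b.2) : gC) by rewrite adE.
have : (lambda rho)%:C%C *: b = (a * lambda mu + lambda nu)%:C%C *: b.
  rewrite -kb e rmorphD rmorphM scalerDl -[_ * _ *: b]scalerA -!kb.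
  rewrite !adr !scale_iE !scale_realE; congr pair => /=.
    by rewrite brl opprD scalerN.
  by rewrite brl.
move=> /eqP; rewrite -subr_eq0 -scalerBl scaler_eq0 (negbTE b0) orbF subr_eq0.
by move=> /eqP /complexI.
Qed.

(** [None] indexes z(t), which is the weight space of 0. As 0 is excluded from [nonzero_weights],
    distinct indices carry distinct weights, so the components are mutually orthogonal. *)
Let weight_of (p : option (t -> R)) : t -> R := if p is Some lambda then lambda else 0.
Let component (p : option (t -> R)) : set gC :=
  if p is Some lambda then k lambda else commuting_part br t S.
Let weights : set (option (t -> R)) := None |` Some @` nonzero_weights br S.

Let componentE p : component p = k (weight_of p).
Proof. by case: p => //=; exact: commuting_part_weight0. Qed.

Let component_orthogonal p p' z w : weights p -> weights p' -> p <> p' ->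
  component p z -> component p' w -> hC z w = 0.
Proof.
move=> wo wo' oo'; rewrite !componentE; apply: weight_spaces_orthogonal => e.
apply: oo'; case: p p' wo wo' e => [l|] [l'|] //=.
- by move=> _ _ ->.
- by move=> [//|[l2 [_ /eqP l0 _] [<-]]] _ /l0.
- by move=> _ [//|[l2 [_ /eqP l0 _] [<-]]] /esym /l0.
Qed.

(** An orthogonal basis of common eigenvectors, grouped by weight, gives the sum; orthogonality of
    the components makes it direct. *)
Lemma weight_decomposition : finite_dimensional S ->
  is_direct_sum S weights component.
Proof.
move=> fS; have [n dS] := finite_dimensional_dim_le fS.
have hP := hermitian_ext_inner kappaP.
split=> [p _| |z [zk z0 zfin]].
- by rewrite componentE; exact: weight_space_subspace.
- apply/seteqP; split=> [v Sv|_ [z [zk z0 zfin] ->]]; last first.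
    have [s [us zs]] := finite_support_seq zfin.
    rewrite (fsum_seq us) //; elim/big_ind : _ => [|u w Su Sw|p _].
    + exact: subspace0.
    + by rewrite -[u]scale1r; exact: subspaceP.
    + have [wo|/z0 ->] := pselect (weights p); last exact: subspace0.
      by have := zk p wo; rewrite componentE => -[].
  have [||||r [b [a [Sb Tb bspan]]]] :=
    @orthogonal_common_eigenbasis _ _ hC hP n t S
      (fun mu z => 'i%C *: ad (\val mu) z) _ _ _ sS dS _.
  + by move=> mu c u w /=; rewrite ad_linear // scalerDr !scalerA mulrC.
  + move=> mu nu w /=; rewrite !adZ //; congr (_ *: (_ *: _)).
    by apply: ad_comm => //; apply: t_ab.2; exact: set_valP.
  + by move=> mu u w; apply: (hermitian_ad brl kappaP t_inv); exact: set_valP.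
  + by move=> mu w Sw; apply: subspaceZ => //; apply: adS => //; exact: set_valP.
  pose lam i : t -> R := fun mu => complex.Re (a i mu).
  have klam i : k (lam i) (b i).
    case: (Sb i) => Sbi b0; split=> // mu.
    by rewrite Tb -(weights_real b0 (Tb i)).
  (* Eigenvectors of weight 0 are sent to the component z(t). *)
  pose idx i : option (t -> R) := if lam i == 0 then None else Some (lam i).
  have idxW i : weights (idx i).
    rewrite /idx; case: eqVneq => [_|l0]; [by left|right; exists (lam i) => //].
    case: (Sb i) => _ b0; split=> //; last by exists (b i).
    exact: weight_dual b0 (klam i).
  have idxk i : component (idx i) (b i).
    rewrite componentE /idx; case: eqVneq => [l0|_]; last exact: klam.
    by rewrite /= -l0; exact: klam.
  pose c i := hC v (b i) / hC (b i) (b i).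
  (* Several basis vectors may share a weight, so their terms are collected. *)
  pose z p := \sum_(i | idx i == p) c i *: b i.
  have z0 p : p \notin [seq idx i | i : 'I_r] -> z p = 0.
    move=> oidx; apply: big1 => i /eqP io.
    by case/negP: oidx; apply/mapP; exists i; rewrite ?mem_enum.
  exists z; first split.
  + move=> p _; rewrite componentE /z.
    elim/big_ind : _ => [|u w ku kw|i /eqP <-].
    * by apply: subspace0; exact: weight_space_subspace.
    * rewrite -[u]scale1r; apply: subspaceP => //; exact: weight_space_subspace.
    * apply: subspaceZ; first exact: weight_space_subspace.
      by rewrite -componentE; exact: idxk.
  + by move=> p wo; apply: big1 => i /eqP io; case: wo; rewrite -io.
  + apply: (@sub_finite_set _ _ [set` [seq idx i | i : 'I_r]]) (finite_seq _) => p /=.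
    by apply: contraNT => /z0 ->.
  rewrite [LHS]bspan // (@fsum_seq _ _ _ _ (undup [seq idx i | i : 'I_r])).
  + rewrite (eq_bigr (fun p => \sum_i if idx i == p then c i *: b i else 0)).
      2: by move=> p _; rewrite /z big_mkcond.
    rewrite exchange_big; apply: eq_bigr => i _ /=.
    rewrite (bigD1_seq (idx i)) ?undup_uniq //=; last first.
      by rewrite mem_undup; apply/mapP; exists i; rewrite ?mem_enum.
    rewrite eqxx big1 ?addr0 // => p.
    by rewrite eq_sym => /negbTE ->.
  + exact: undup_uniq.
  + by move=> p; rewrite mem_undup; exact: z0.
  + by move=> p wo; apply: big1 => i /eqP io; case: wo; rewrite -io.
- have [s [us zs]] := finite_support_seq zfin.
  rewrite (fsum_seq us) // => sum0 p.
  have [wo|/z0 //] := pselect (weights p).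
  have [os|/zs //] := boolP (p \in s).
  (* Pairing the vanishing sum with [z p] kills all other terms by orthogonality and leaves the form
     of [z p] with itself. *)
  apply/eqP/negPn/negP => /(herm_neq0 hP) /eqP; apply.
  have : hC (\sum_(i <- s) z i) (z p) = 0 by rewrite sum0 herm0.
  rewrite (bigD1_seq p) //= hermD // => hz; rewrite -[RHS]hz -[LHS]addr0.
  congr (_ + _); elim/big_rec : _ => [|i u io hu]; first by rewrite herm0.
  rewrite hermD // -hu addr0.
  have [wi|/z0 ->] := pselect (weights i); last by rewrite herm0.
  rewrite (component_orthogonal wi wo _ (zk _ wi) (zk _ wo)) //.
  exact/eqP.
Qed.

End WeightDecomposition.

(** A finite real spanning family of [g] spans g_C over the complex numbers, with coefficients c + i
    d built from those of the real and imaginary parts. *)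
Lemma finite_dimensional_complexification {R : realType} {g : lmodType R}
    (S : set (complexification g)) :
  finite_dimensional [set: g] -> finite_dimensional S.
Proof.
move=> [n [b bP]]; exists n, (fun i => real_part_embed (b i)) => z _.
have [c zc] := bP z.1 I; have [d zd] := bP z.2 I.
exists (fun i => (c i +i* d i)%C); rewrite [LHS]surjective_pairing zc zd.
have -> (F : 'I_n -> complexification g) :
    \sum_i F i = (\sum_i (F i).1, \sum_i (F i).2).
  by elim/big_rec3 : _ => // i x y _ _ ->.
by congr pair; apply: eq_bigr => i _ /=; rewrite scaler0 ?subr0 ?add0r.
Qed.

(** * The complex stabilizer: complex linearity and invariance under ad t *)

Section ComplexStabilizer.
Context {R : realType} {M : topologicalType} {E : tvsType R}.
Context (A : atlas M E) (cA : covering_atlas A) (hE : hausdorff_space E).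
Context {G : preTopologicalGroupType} {g : tvsType R}.
Context (AG : atlas G g) (hg : hausdorff_space g) (lieG : is_lie_group AG).
Context (expG : g -> G) (expP : is_exponential AG expG).
Context (Ups : G -> M -> M) (actP : smooth_left_action A AG Ups).
Context (j : M -> E -> E) (acs : almost_complex A j) (m : M).

Local Notation gCm := (complex_stabilizer A expG Ups j m).
Local Notation act xi := (inf_action A expG Ups xi m).

Let act_linear : linear (fun xi => act xi).
Proof. exact: (inf_action_linear cA hE hg lieG expP actP). Qed.

Let j_linear : linear (j m).
Proof. by case: acs. Qed.

Let act0 : act 0 = 0.
Proof. exact: linear_map0 act_linear. Qed.
Let actZ a xi : act (a *: xi) = a *: act xi.
Proof. exact: linear_mapZ act_linear _ _. Qed.
Let actD xi eta : act (xi + eta) = act xi + act eta.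
Proof. exact: linear_mapD act_linear _ _. Qed.

(** Since j_m squares to -1, the extended action carries multiplication by a to Re a + (Im a) j_m,
    so its kernel is a complex subspace. *)
Lemma complex_stabilizer_subspace : is_subspace gCm.
Proof.
have jj X : j m (j m X) = - X by case: acs.
pose Z (z : complexification g) := complex_inf_action A expG Ups j z m.
have ZD z w : Z (z + w) = Z z + Z w.
  by rewrite /Z /complex_inf_action /= !actD (linear_mapD j_linear) addrACA.
have ZZ a z : Z (a *: z) = complex.Re a *: Z z + complex.Im a *: j m (Z z).
  rewrite /Z /complex_inf_action /= !actD -scaleN1r !actZ.
  rewrite !(linear_mapD j_linear) !(linear_mapZ j_linear) jj.
  rewrite !scalerDr scaleN1r scalerN addrACA; congr (_ + _).
  by rewrite addrC.
split=> [|a z w]; rewrite !inE /complex_stabilizer /=.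
  by rewrite /complex_inf_action /= act0 (linear_map0 j_linear) addr0.
by rewrite -!/(Z _) ZD ZZ => -> ->; rewrite (linear_map0 j_linear) !scaler0 !addr0.
Qed.

(** L is additive and commutes with j_m, so [mu, z] acts at [m] as L applied to z . m, and L 0 =
    0. *)
Lemma ad_complex_stabilizer mu z : stabilizer A expG Ups m mu ->
  (forall X, tau' A expG Ups j mu m X = 0) -> gCm z ->
  gCm (bilinear_ext (bracket AG) (real_part_embed mu) z).
Proof.
move=> mu0 jmu; rewrite /complex_stabilizer /= adE; last exact: bracket_linearl.
rewrite /complex_inf_action /= => z0.
have cj := almost_complex_continuous (m := m) cA hE acs.
rewrite !(isotropy_inf_action cA hE hg lieG expP actP mu0).
rewrite -(isotropy_almost_complex cA hE hg lieG expP actP mu0) //.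
rewrite -(isotropyD cA hE hg lieG expP actP mu0) z0.
apply: (addrI (isotropy A expG Ups m mu 0)).
by rewrite -(isotropyD cA hE hg lieG expP actP mu0) !addr0.
Qed.

End ComplexStabilizer.

Theorem theorem3p5 (R : realType)
  (E : tvsType R) (frE : frechet_space E)
  (M : topologicalType) (A : atlas M E) (manM : is_manifold A)
  (connM : connected [set: M])
  (omega : M -> E -> E -> R) (sympl : symplectic_form A omega)
  (g : tvsType R) (frg : frechet_space g)
  (G : preTopologicalGroupType) (AG : atlas G g) (lieG : is_lie_group AG)
  (expG : g -> G) (expP : is_exponential AG expG)
  (Ups : G -> M -> M) (actP : symplectic_action A AG Ups omega)
  (j : M -> E -> E) (acs : almost_complex A j) (compat : compatible omega j)
  (kappa : g -> g -> R) (kappaP : inner_pairing kappa)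
  (J : M -> g) (momJ : momentum_map A expG Ups omega kappa J)
  (m : M) (t : set g) (t_stab : t `<=` stabilizer A expG Ups m)
  (t_ab : abelian_subalgebra (bracket AG) t)
  (j_inv : forall mu X, t mu -> tau' A expG Ups j mu m X = 0)
  (kappa_inv : invariant_pairing (bracket AG) kappa t)
  (infinite_dim :
    ~ (finite_dimensional [set: E] /\ finite_dimensional [set: g]) ->
    [/\ forall xi, exists ad_adj : g -> g, forall eta zeta,
          kappa (bracket AG xi eta) zeta = kappa eta (ad_adj zeta),
        exists Sigma_kappa : g -> g, forall xi eta,
          kappa (Sigma_kappa xi) eta
            = cocycle A AG expG Ups omega kappa J m xi eta &
        finite_dimensional (complex_stabilizer A expG Ups j m)]) :
  let gCm := complex_stabilizer A expG Ups j m in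
  let z_t := commuting_part (bracket AG) t gCm in
  let k := weight_space (bracket AG) gCm : (t -> R) -> set _ in
  [/\ is_direct_sum gCm
        (None |` Some @` nonzero_weights (bracket AG) gCm)
        (fun i : option (t -> R) => if i is Some lambda then k lambda else z_t),
      [set zeta | t zeta.1 /\ t zeta.2] `<=` z_t,
      z_t = k 0,
      forall lambda nu : t -> R, dual_space lambda -> dual_space nu ->
        linear_span [set bilinear_ext (bracket AG) z w | z in k lambda & w in k nu]
          `&` gCm `<=` k (lambda + nu) &
      forall lambda nu : t -> R, dual_space lambda -> dual_space nu ->
        lambda <> nu -> forall z w, k lambda z -> k nu w ->
        hermitian_ext kappa z w = 0].

Proof.
have hE : hausdorff_space E by case: frE.
have hg : hausdorff_space g by case: frg.
have cA : covering_atlas A by case: manM.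
have smact := actP.1.
have brl := bracket_linearl hg lieG; have brr := bracket_linearr hg lieG.
have brJ := jacobi hg lieG expP.
move=> gCm z_t k.
have sS : is_subspace gCm.
  exact: (complex_stabilizer_subspace cA hE hg lieG expP smact acs).
have adS mu z : t mu -> gCm z ->
    gCm (bilinear_ext (bracket AG) (real_part_embed mu) z).
  move=> tmu.
  apply: (ad_complex_stabilizer cA hE hg lieG expP smact acs) => [|X].
    exact: t_stab.
  exact: j_inv.
(* In infinite dimensions this is assumption (3); otherwise it is inherited from [g]. *)
have fS : finite_dimensional gCm.
  have [[_ fg]|/infinite_dim[_ _] //] :=
    pselect (finite_dimensional [set: E] /\ finite_dimensional [set: g]).
  exact: finite_dimensional_complexification.
split.
- exact: (weight_decomposition brl brr brJ kappaP t_ab kappa_inv sS adS fS).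
- move=> z [tz1 tz2]; split.
    rewrite /gCm /complex_stabilizer /= /complex_inf_action.
    rewrite (t_stab _ tz1) (t_stab _ tz2) add0r.
    by case: acs => lj _ _; rewrite (linear_map0 (lj m)).
  by move=> mu tmu; rewrite (adE brl) /= !t_ab.2.
- exact: commuting_part_weight0.
- by move=> lambda nu _ _; exact: (weight_space_bracket brl brr brJ).
- move=> lambda nu _ _ ln z w kz kw.
  exact: (weight_spaces_orthogonal brl kappaP kappa_inv ln kz kw).
Qed.
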